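(* Let $d\ge 1$, let $A:[0,\infty)\to\mathbb R^{d\times d}$ be locally integrable, and consider the linear differential equation $\dot x=A(t)x$. Then its Bohl spectrum $\Sigma_{\rm Bohl}\subset\overline{\mathbb R}$ consists of $k$ (not necessarily closed) disjoint intervals, where $1\le k\le d$; that is, $\Sigma_{\rm Bohl}$ has exactly $k$ connected components $I_1,\dots,I_k$, which are nonempty intervals of $\overline{\mathbb R}$ ordered so that every element of $I_i$ is smaller than every element of $I_{i+1}$, and $$\Sigma_{\rm Bohl}=I_1\cup\dots\cup I_k .$$ The interval $I_1$ can be unbounded from below, $I_k$ can be unbounded from above, and $I_2,\dots,I_{k-1}$ are bounded. Moreover, there exists a corresponding filtration of linear subspaces of $\mathbb R^d$, $$\{0\}=\mathcal S_0\subsetneq \mathcal S_1\subsetneq\mathcal S_2\subsetneq\dots\subsetneq\mathcal S_k=\mathbb R^d,$$ satisfying $$\mathcal S_i\setminus\{0\}=\Big\{\xi\in\mathbb R^d\setminus\{0\}:\ \Sigma_\xi\subset \bigcup_{j=1}^i I_j\Big\}\quad\text{for all } i\in\{1,\dots,k\}.$$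
   Context: Locally integrable means $\int_a^b\|A(t)\|\,\mathrm dt<\infty$ for all $0\le a<b$. Let $X(t)$ be the fundamental matrix of $\dot x=A(t)x$ with $X(0)$ the identity, so $X(\cdot)\xi$ is the (absolutely continuous) solution with initial value $\xi$ at time $0$. Put $\overline{\mathbb R}=\mathbb R\cup\{-\infty,\infty\}$ with its usual order and topology. For $\xi\in\mathbb R^d\setminus\{0\}$, the Bohl spectrum $\Sigma_\xi$ of the solution $X(\cdot)\xi$ is the set of all $\lambda\in\overline{\mathbb R}$ for which there are sequences $t_n,s_n\in[0,\infty)$ with $t_n-s_n\to\infty$ and $\lim_{n\to\infty}\frac1{t_n-s_n}\ln\frac{\|X(t_n)\xi\|}{\|X(s_n)\xi\|}=\lambda$. The Bohl spectrum of the equation is $\Sigma_{\rm Bohl}=\bigcup_{\xi\in\mathbb R^d\setminus\{0\}}\Sigma_\xi$. An interval of $\overline{\mathbb R}$ is an order-convex subset (single points allowed, the elements $\pm\infty$ may belong to it); ''bounded'' means contained in a bounded subset of $\mathbb R$. *)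

(* Defs.v *)
From HB Require Import structures.
From mathcomp Require Export all_boot all_order all_algebra.
From mathcomp Require Export all_classical all_reals all_analysis.
Export Order.TTheory GRing.Theory Num.Theory.
Export numFieldNormedType.Exports.

Set Implicit Arguments.
Unset Strict Implicit.
Unset Printing Implicit Defensive.

Local Open Scope classical_set_scope.
Local Open Scope ring_scope.

(* R equipped with the sigma-algebra of Lebesgue (not only Borel) measurable
   sets, the domain of completed_lebesgue_measure. *)
Notation lebesgueType R :=
  (caratheodory_type ((@wlength R idfun)^*)%mu).

Section LinearODE.
Context {R : realType} {d : nat}.
Implicit Types (A X : R -> 'M[R]_d) (xi : 'cV[R]_d).

(* A coefficient is a function on R of which only the restriction to [0, oo[
   matters. Here and below `|_| is the max norm; all norms on a
   finite-dimensional space give the same notions. *)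
Definition locally_integrable_coef A :=
  (forall i j, @measurable_fun _ _ (lebesgueType R) R
     (`[0, +oo[%classic : set R) (fun t => A t i j)) /\
  (forall a b : R, 0 <= a < b ->
     (\int[completed_lebesgue_measure]_(t in (`[a, b]%classic : set R))
        (`|A t|)%:E < +oo)%E).

Definition absolutely_continuous_on {V : normedModType R} (a b : R)
    (f : R -> V) :=
  forall e : R, 0 < e -> exists2 delta : R, 0 < delta &
    forall (n : nat) (u v : 'I_n -> R),
      (forall k, a <= u k /\ u k < v k /\ v k <= b) ->
      trivIset setT (fun k => `]u k, v k[%classic) ->
      \sum_(k < n) (v k - u k) < delta ->
      \sum_(k < n) `|f (v k) - f (u k)| < e.

(* The matrix solution, in the sense of Caratheodory, of X' = A X on [0, oo[
   with X 0 = 1. *)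
Definition fundamental_matrix A X :=
  [/\ X 0 = 1%:M,
      forall b : R, 0 < b -> absolutely_continuous_on 0 b X &
      {ae @completed_lebesgue_measure R, forall t : R,
         0 <= t -> is_derive t 1 X (A t *m X t)}].

Definition solution_bohl_spectrum X xi : set (\bar R) :=
  [set lambda | exists t s : nat -> R,
    [/\ forall n, 0 <= t n /\ 0 <= s n,
        (t n - s n) @[n --> \oo] --> +oo &
        ((t n - s n)^-1 * ln (`|X (t n) *m xi| / `|X (s n) *m xi|))%:E
          @[n --> \oo] --> lambda]].

Definition bohl_spectrum X : set (\bar R) :=
  \bigcup_(xi in [set xi : 'cV[R]_d | xi != 0]) solution_bohl_spectrum X xi.

End LinearODE.

Section ExtendedRealSets.
Context {R : realType}.
Implicit Types (J Sigma : set (\bar R)) (I : nat -> set (\bar R)).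
Local Open Scope ereal_scope.

Definition is_ereal_interval J :=
  forall x y, J x -> J y -> forall z, x <= z <= y -> J z.

Definition ereal_bounded J :=
  exists2 B : set R, bounded_set B & J `<=` EFin @` B.

Definition unbounded_below J := forall M : R, exists2 x, J x & x < M%:E.

Definition unbounded_above J := forall M : R, exists2 x, J x & M%:E < x.

(* I 1, ..., I k are the connected components of Sigma, in increasing order
   (the other values of I are irrelevant). *)
Definition ordered_components Sigma (k : nat) I :=
  [/\ forall i, (1 <= i <= k)%N -> I i !=set0 /\ is_ereal_interval (I i),
      forall i, (1 <= i < k)%N -> forall x y, I i x -> I i.+1 y -> x < y,
      [set connected_component Sigma x | x in Sigma] =
        [set I i | i in [set i | (1 <= i <= k)%N]] &
      Sigma = \bigcup_(i in [set i | (1 <= i <= k)%N]) I i].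

End ExtendedRealSets.

(* Main.v *)
Require Import Defs.
From mathcomp Require Import ring lra measurable_realfun.

Set Implicit Arguments.
Unset Strict Implicit.
Unset Printing Implicit Defensive.

Local Open Scope classical_set_scope.
Local Open Scope ring_scope.

(** Why the theorem holds.  Put phi(t) = ln |X(t) xi|; the Bohl spectrum of the
solution through xi is the set of limits of the slopes
(phi(t) - phi(s)) / (t - s) along t - s -> oo.  The pairs (t, s) with
t - s >= n form a convex set, so by the intermediate value theorem the slopes
over it fill an interval; hence every Sigma_xi is an interval of the extended
line ([slope_spectrum_interval]), and it is nonempty by compactness
([slope_spectrum_nonempty]).

Let lambda be a real number outside Sigma_Bohl.  Each Sigma_xi lies entirely
below or entirely above lambda, and it lies below exactly when
|X(t) xi| <= C e^(lambda t) for some C ([slope_spectrum_below]).  This growth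
condition is linear in xi, although a bound on the slopes of the solution is
not: slopes compare |X(t) xi| with |X(s) xi|, which may be small for a sum of
solutions.  So the xi with Sigma_xi below lambda form, with 0, a subspace
S_lambda, and S_lambda grows with lambda.  Together with 0 and R^d these
subspaces form a chain, which is finite:
0 = S_0 < S_1 < ... < S_k = R^d with k <= d.

Let I_i be the union of the Sigma_xi over the layer S_i \ S_(i-1).  Consecutive
layers are separated by a real number outside the spectrum.  Conversely a real
number z outside the spectrum between two points of the same I_i would give a
subspace S_z strictly between S_(i-1) and S_i, which does not exist.  So the I_i
are order convex and they are the connected components of Sigma_Bohl
([spectral_filtration]).

All this needs X(t) xi <> 0 for xi <> 0, which is uniqueness for the
Caratheodory equation ([flow_nonvanishing]).  It rests on a mean value
inequality for absolutely continuous functions ([ac_increment_le]), applied with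
a monotone majorant of the integral of the norm of A ([integral_majorant]).

For the unbounded components take A(t) = 2 c t with c = 1 or c = -1, so that
X(t) = e^(c t^2): the slope between 0 and n is c n, and c * oo is in the
spectrum. *)

(** * Slopes of a function over long intervals *)

Section SlopeSpectrum.
Context {R : realType}.
Implicit Types (phi : R -> R) (lam : R) (x y z : \bar R).

Definition slope phi (t s : R) : R := (t - s)^-1 * (phi t - phi s).

Definition slope_spectrum phi : set (\bar R) :=
  [set x | exists t s : nat -> R,
    [/\ forall n, 0 <= t n /\ 0 <= s n,
        (t n - s n) @[n --> \oo] --> +oo &
        (slope phi (t n) (s n))%:E @[n --> \oo] --> x]].

(** [P] may depend on the length [n] of the interval, so that tolerances can
shrink along the sequence extracted by [frequent_slope_seq]. *)
Definition frequent_slope phi (P : nat -> R -> Prop) :=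
  forall n : nat, exists t s : R,
    [/\ 0 <= t, 0 <= s, n%:R <= t - s & P n (slope phi t s)].

Lemma frequent_slope_seq phi P : frequent_slope phi P ->
  exists t s : nat -> R,
    [/\ forall n, 0 <= t n /\ 0 <= s n,
        forall n, n%:R <= t n - s n &
        forall n, P n (slope phi (t n) (s n))].
Proof.
move=> H; have {}H n : exists ts : R * R,
   [/\ 0 <= ts.1, 0 <= ts.2, n%:R <= ts.1 - ts.2 & P n (slope phi ts.1 ts.2)].
  by have [t [s ?]] := H n; exists (t, s).
have [f Hf] := choice H.
by exists (fun n => (f n).1), (fun n => (f n).2); split=> n; case: (Hf n).
Qed.

Lemma gap_cvg_pinfty (u : nat -> R) (e : nat -> nat) :
  (forall n, n%:R <= u n) -> (forall n, (n <= e n)%N) ->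
  u (e n) @[n --> \oo] --> +oo.
Proof.
move=> hu he; apply/cvgryPge => B; near=> n.
apply: le_trans (hu _); apply: (@le_trans _ _ n%:R); last by rewrite ler_nat.
by near: n; exact: nbhs_infty_ger.
Unshelve. all: by end_near. Qed.

Lemma slopeN phi t s : slope (fun t => - phi t) t s = - slope phi t s.
Proof. by rewrite /slope; ring. Qed.

Lemma slope_spectrum_opp phi x :
  slope_spectrum (fun t => - phi t) x <-> slope_spectrum phi (- x)%E.
Proof.
split=> -[t [s [h0 h1 h2]]]; exists t, s; split=> //.
  move/cvgeN: h2; apply: cvg_trans; apply: near_eq_cvg; near=> n.
  by rewrite /= slopeN opprK.
move/cvgeN: h2; rewrite oppeK; apply: cvg_trans; apply: near_eq_cvg; near=> n.
by rewrite /= slopeN.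
Unshelve. all: by end_near. Qed.

(** Compactness of [\bar R], in the only form used.  Either the slopes on ever
longer intervals are unbounded above and +oo is in the spectrum, or they are
eventually bounded and Bolzano-Weierstrass applies.  The tolerance [e] makes the
lemma usable when [lam] is only approached. *)
Lemma slope_spectrum_ge phi lam :
  (forall e, 0 < e -> frequent_slope phi (fun _ r => lam - e <= r)) ->
  exists2 x, slope_spectrum phi x & (lam%:E <= x)%E.
Proof.
move=> H.
have [Hy|] := pselect (frequent_slope phi (fun n r => n%:R <= r)).
  exists +oo%E; last exact: leey.
  have [t [s [h0 h1 h2]]] := frequent_slope_seq Hy.
  exists t, s; split=> //; first exact: (gap_cvg_pinfty (e := id) h1).
  apply/cvgeryP; exact: (gap_cvg_pinfty (e := id) h2).
move=> /existsNP[N HN].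
have ub t s : 0 <= t -> 0 <= s -> N%:R <= t - s -> slope phi t s <= N%:R.
  move=> t0 s0 ts; rewrite leNgt; apply/negP => /ltW h.
  by apply: HN; exists t, s.
have {}H : frequent_slope phi (fun n r => lam - n.+1%:R^-1 <= r).
  by move=> n; apply: (H _ _ n); rewrite invr_gt0.
have [t [s [h0 h1 h2]]] := frequent_slope_seq H.
(* shifting by N puts every term in the range where slopes are at most N *)
pose u n := slope phi (t (n + N)%N) (s (n + N)%N).
have ulam n : lam - n.+1%:R^-1 <= u n.
  apply: le_trans (h2 _); rewrite lerD2l lerN2 lef_pV2 ?posrE ?ltr0n//.
  by rewrite ler_nat ltnS leq_addr.
have ulam1 n : lam - 1 <= u n.
  by apply: le_trans (ulam n); rewrite lerD2l lerN2 invf_le1 ?ler1n ?ltr0n.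
have uN n : u n <= N%:R.
  have [? ?] := h0 (n + N)%N.
  by apply: ub => //; apply: le_trans (h1 _); rewrite ler_nat leq_addl.
have bu : bounded_fun u.
  exists (Num.max `|lam - 1| N%:R); split; first exact: num_real.
  move=> M hM n _ /=; rewrite ler_norml.
  move: hM; rewrite gt_max => /andP[l1 l2].
  apply/andP; split.
    apply: le_trans (ulam1 n); rewrite lerNl; apply: ltW; apply: le_lt_trans l1.
    by rewrite -normrN ler_norm.
  by apply: le_trans (uN n) _; exact: ltW.
have [f fi /cvg_ex[l ul]] := bolzano_weierstrass bu.
have fge n : (n <= f n)%N.
  elim: n => // n IH; apply: leq_ltn_trans IH _.
  by rewrite -[X in is_true X]/(f n < f n.+1)%O (leW_mono fi) ltEnat /=.
exists l%:E.
  exists (fun n => t (f n + N)%N), (fun n => s (f n + N)%N); split.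
  - by move=> n; exact: h0.
  - apply: (@gap_cvg_pinfty (fun n => t n - s n) (fun n => f n + N)%N) => // n.
    exact: leq_trans (fge n) (leq_addr _ _).
  - apply: cvg_comp ul _; exact: cvg_id.
rewrite lee_fin; apply/ler_addgt0Pr => e e0; rewrite -lerBlDr.
apply: (cvgr_to_ge ul); near=> n; apply: le_trans (ulam _).
rewrite lerD2l lerN2; apply: (@le_trans _ _ n.+1%:R^-1).
  by rewrite lef_pV2 ?posrE ?ltr0n// ler_nat ltnS fge.
by apply: ltW; near: n; exact: near_infty_natSinv_lt (PosNum e0).
Unshelve. all: by end_near. Qed.

Lemma slope_spectrum_le phi lam :
  (forall e, 0 < e -> frequent_slope phi (fun _ r => r <= lam + e)) ->
  exists2 x, slope_spectrum phi x & (x <= lam%:E)%E.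
Proof.
move=> H; have [|x] := @slope_spectrum_ge (fun t => - phi t) (- lam).
  move=> e e0 n; have [t [s [h0 h1 h2 h3]]] := H e e0 n; exists t, s.
  by split=> //; rewrite slopeN -opprD lerN2.
by move=> /slope_spectrum_opp hx; rewrite EFinN leeNl; exists (- x)%E.
Qed.

Lemma slope_spectrum_nonempty phi : slope_spectrum phi !=set0.
Proof.
have [H|] := pselect (frequent_slope phi (fun _ r => 0 <= r)).
  have [e e0 n|x] := @slope_spectrum_ge phi 0; last by exists x.
  have [t [s [? ? ? h]]] := H n; exists t, s; split=> //.
  by apply: le_trans h; rewrite sub0r oppr_le0 ltW.
move=> /existsNP[N HN].
have [e e0 n|x] := @slope_spectrum_le phi 0; last by exists x.
exists (n + N)%:R, 0; rewrite subr0; split=> //.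
  by rewrite ler_nat leq_addr.
rewrite add0r leNgt; apply/negP => h; apply: HN.
exists (n + N)%:R, 0; rewrite subr0 ler_nat leq_addl; split=> //.
by apply: ltW; exact: lt_trans h.
Qed.

Lemma slope_spectrum_lt_frequent phi x lam : slope_spectrum phi x ->
  (x < lam%:E)%E -> frequent_slope phi (fun _ r => r < lam).
Proof.
move=> [t [s [h0 h1 h2]]] xl N.
have H1 : \forall n \near \oo, N%:R <= t n - s n by move/cvgryPge: h1; exact.
have H2 : \forall n \near \oo, slope phi (t n) (s n) < lam.
  have := h2 _ (open_nbhs_nbhs (conj (open_ereal_lt_ereal (x := lam%:E)) xl)).
  by rewrite /nbhs /=; apply: filterS => n; rewrite /= lte_fin.
have [n [? ?]] := filter_ex (filterI H1 H2).
by exists (t n), (s n); have [] := h0 n.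
Qed.

Lemma slope_spectrum_gt_frequent phi x lam : slope_spectrum phi x ->
  (lam%:E < x)%E -> frequent_slope phi (fun _ r => lam < r).
Proof.
rewrite -[x]oppeK => /slope_spectrum_opp h xl N.
have [|t [s [? ? ? hs]]] := slope_spectrum_lt_frequent (lam := - lam) h _ N.
  by rewrite EFinN lteNr.
exists t, s; split=> //; move: hs.
by rewrite slopeN ltrN2.
Qed.

(** A slope below z and a slope above z, both over intervals longer than n, are
joined by a segment of pairs (t, s) that keeps t - s above n; on it the slope
takes the value z exactly.  So z is even the limit of a constant sequence. *)
Lemma slope_spectrum_interval phi :
  continuous phi -> is_ereal_interval (slope_spectrum phi).
Proof.
move=> cphi x y Sx Sy z /andP[xz zy].
have [<-//|/eqP xnz] := pselect (x = z).
have [->//|/eqP zny] := pselect (z = y).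
have {}xz : (x < z)%E by rewrite lt_neqAle xnz.
have {}zy : (z < y)%E by rewrite lt_neqAle zny.
case: z xz zy {xnz zny} => [lam xz zy|_|]; last first.
- by rewrite ltNge leNye.
- by rewrite ltNge leey.
have H : frequent_slope phi (fun _ r => r = lam).
  move=> n.
  have [t0 [s0 [t00 s00 ts0 lo]]] := slope_spectrum_lt_frequent Sx xz n.+1.
  have [t1 [s1 [t10 s10 ts1 hi]]] := slope_spectrum_gt_frequent Sy zy n.+1.
  have gap0 : 0 < t0 - s0 by apply: lt_le_trans ts0.
  have gap1 : 0 < t1 - s1 by apply: lt_le_trans ts1.
  pose t r : R := t0 + r * (t1 - t0); pose s r : R := s0 + r * (s1 - s0).
  (* clearing the denominator: p vanishes where the slope equals lam *)
  pose p r := phi (t r) - phi (s r) - lam * (t r - s r).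
  have ct : continuous t.
    by move=> r; apply: cvgD; [exact: cvg_cst|apply: cvgMl; exact: cvg_id].
  have cs : continuous s.
    by move=> r; apply: cvgD; [exact: cvg_cst|apply: cvgMl; exact: cvg_id].
  have cp : {within `[0, 1], continuous p}.
    apply: continuous_subspaceT => r; apply: cvgB.
      apply: cvgB; [have h := ct r|have h := cs r].
        exact: (cvg_comp _ _ h (cphi _)).
      exact: (cvg_comp _ _ h (cphi _)).
    by apply: cvgMr; apply: cvgB; [exact: ct|exact: cs].
  have p0 : p 0 <= 0.
    rewrite /p /t /s !mul0r !addr0 subr_le0.
    by move: lo; rewrite /slope mulrC ltr_pdivrMr// => /ltW.
  have p1 : 0 <= p 1.
    rewrite /p /t /s !mul1r !subrKC subr_ge0.
    by move: hi; rewrite /slope mulrC ltr_pdivlMr// => /ltW.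
  have [|r] := @IVT _ p 0 1 0 ler01 cp.
    by rewrite ge_min le_max p0 p1 orbT.
  rewrite in_itv/= => /andP[r0 r1] pr.
  have gap : n.+1%:R <= t r - s r by rewrite /t /s; nra.
  exists (t r), (s r); split.
  - rewrite /t; nra.
  - rewrite /s; nra.
  - by apply: le_trans gap; rewrite ler_nat.
  - have gr : 0 < t r - s r by apply: lt_le_trans gap.
    move: pr => /subr0_eq pr.
    by rewrite /slope pr mulrC mulfK// gt_eqF.
have [t [s [h0 h1 h2]]] := frequent_slope_seq H.
exists t, s; split=> //; first exact: (gap_cvg_pinfty (e := id) h1).
by under eq_fun do rewrite h2; exact: cvg_cst.
Qed.

(** The right-hand side compares [phi] at two arbitrary points, the left-hand
side only with its value at 0.  They agree because a spectrum that misses [lam]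
lies on one side of it, so one well-chosen family of slopes, those starting at
0, decides which side. *)
Lemma slope_spectrum_below phi lam : continuous phi ->
  ~ slope_spectrum phi lam%:E ->
  (exists M, forall t, 0 <= t -> phi t <= M + lam * t) <->
  slope_spectrum phi `<=` [set x | (x < lam%:E)%E].
Proof.
move=> cphi nlam; split=> [[M HM] x Sx /=|H].
  have [y Sy ylam] : exists2 y, slope_spectrum phi y & (y <= lam%:E)%E.
    apply: slope_spectrum_le => e e0 n.
    (* far enough for the constant M to contribute at most e to the slope *)
    pose t := Num.max n.+1%:R ((M - phi 0) / e).
    have t0 : 0 < t by rewrite lt_max ltr0n.
    exists t, 0; rewrite subr0; split=> //; first exact: ltW.
      by rewrite le_max ler_nat leqnSn.
    rewrite /slope subr0 mulrC ler_pdivrMr//.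
    have : M - phi 0 <= t * e by rewrite -ler_pdivrMr// le_max lexx orbT.
    have := HM t (ltW t0); nra.
  rewrite ltNge; apply/negP => lx; apply: nlam.
  by apply: (slope_spectrum_interval cphi Sy Sx); rewrite ylam.
apply: contrapT => HM.
have [y Sy] : exists2 y, slope_spectrum phi y & (lam%:E <= y)%E.
  apply: slope_spectrum_ge => e e0 n.
  pose g t := phi t - lam * t.
  have cg : {within `[0, n%:R], continuous g}.
    apply: continuous_subspaceT => r; apply: cvgB; first exact: cphi.
    by apply: cvgMr; exact: cvg_id.
  (* a point where g exceeds its maximum over [0, n] lies beyond n *)
  have [c _ cmax] := EVT_max (ler0n R n) cg.
  have [t [t0 tM]] : exists t, 0 <= t /\ Num.max (g c) (g 0) < g t.
    apply: contrapT => Hn; apply: HM; exists (Num.max (g c) (g 0)) => t t0.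
    rewrite -lerBlDr leNgt; apply/negP => h; apply: Hn; exists t; split=> //.
  move: tM; rewrite gt_max => /andP[tc tz].
  have nt : n%:R <= t.
    rewrite leNgt; apply/negP => /ltW tn.
    by move: tc; rewrite ltNge cmax// in_itv/= t0.
  have {t0} t0 : 0 < t.
    rewrite lt_neqAle t0 andbT; apply: contraTneq tz => <-.
    by rewrite ltxx.
  exists t, 0; rewrite subr0; split=> //; first exact: ltW.
  rewrite /slope subr0 mulrC ler_pdivlMr//.
  by move: tz; rewrite /g mulr0 subr0; nra.
by rewrite leNgt => /negP; apply; exact: (H y Sy).
Qed.

End SlopeSpectrum.

(** * Intervals of the extended line are its connected subsets *)

Section Connectedness.

Lemma connected_between_closure (T : topologicalType) (A B : set T) :
  connected A -> A `<=` B -> B `<=` closure A -> connected B.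
Proof.
move=> cA AB BA U [u Uu] [C oC UC] [D cD UD].
suff AD : A `<=` D.
  rewrite UD; apply/setIidPl.
  by apply: subset_trans BA _; rewrite (closure_id D).1//; exact: closureS.
have UB : U `<=` B by rewrite UD.
have AUE : A `&` C = A `&` D.
  have ABI : A = A `&` B by apply/esym/setIidPl.
  by rewrite ABI -!setIA -UC -UD.
apply/setIidPl; apply: cA; last by exists D.
  have Cu : C u by move: Uu; rewrite UC => -[].
  have [w [Aw Cw]] := BA _ (UB _ Uu) C (open_nbhs_nbhs (conj oC Cu)).
  by exists w; rewrite -AUE.
by exists C.
Qed.

Context {R : realType}.
Implicit Types (J : set (\bar R)).

Lemma connected_ereal_interval J : connected J -> is_ereal_interval J.
Proof.
move=> cJ x y Jx Jy z /andP[xz zy]; apply: contrapT => nJz.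
have neq w : J w -> w != z by move=> Jw; apply: contra_notN nJz => /eqP <-.
have /esym JE : J `&` [set w | (w < z)%E] = J.
  apply: cJ.
  - by exists x; split => //=; rewrite lt_neqAle neq.
  - by exists [set w | (w < z)%E] => //; exact: open_ereal_lt_ereal.
  - exists [set w | (w <= z)%E]; first exact: closed_ereal_ge_ereal.
    apply/seteqP; split=> w /= [Jw wz]; split=> //; first exact: ltW.
    by rewrite lt_neqAle neq.
by move: Jy; rewrite JE => -[_ /=]; rewrite ltNge zy.
Qed.

(** The real points of [J] form an interval of [R], which is connected, and an
infinite element of [J] is a limit of them as soon as there is one. *)
Lemma ereal_interval_connected J : is_ereal_interval J -> connected J.
Proof.
move=> iJ; pose K := [set r : R | J r%:E].
have [[r Kr]|/nonemptyPn K0] := pselect (K !=set0).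
  apply: (@connected_between_closure _ (EFin @` K)).
  - apply: connected_continuous_connected.
      apply/connected_intervalP => a b Ka Kb c /andP[ac cb].
      by apply: (iJ _ _ Ka Kb); rewrite !lee_fin ac cb.
    by apply: continuous_subspaceT => ?; exact: cvg_id.
  - by move=> _ [s Ks <-].
  - move=> [s| |] Js B.
    + by move=> /nbhs_singleton Bs; exists s%:E; split=> //; exists s.
    + move=> [M [_ MB]]; exists (Num.max r (M + 1))%:E; split.
        exists (Num.max r (M + 1)) => //.
        by apply: (iJ _ _ Kr Js); rewrite leey lee_fin le_max lexx.
      by apply: MB; rewrite lte_fin lt_max ltrDl ltr01 orbT.
    + move=> [M [_ MB]]; exists (Num.min r (M - 1))%:E; split.
        exists (Num.min r (M - 1)) => //.
        by apply: (iJ _ _ Js Kr); rewrite leNye lee_fin ge_min lexx.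
      by apply: MB; rewrite lte_fin gt_min gtrDl ltrN10 orbT.
have nfin r : ~ J r%:E by move=> Jr; move: K0; apply/eqP/set0P; exists r.
have nboth : J -oo%E -> J +oo%E -> False.
  by move=> J1 J2; apply: (nfin 0); apply: (iJ _ _ J1 J2); rewrite leNye leey.
have [Jp|nJp] := pselect (J +oo%E).
  rewrite (_ : J = [set +oo%E]); first exact: connected1.
  apply/seteqP; split=> [[s| |]|_ ->] //= Js; first by case: (nfin s).
  by case: nboth.
have [Jm|nJm] := pselect (J -oo%E).
  rewrite (_ : J = [set -oo%E]); first exact: connected1.
  by apply/seteqP; split=> [[s| |]|_ ->] //= Js; case: (nfin s).
rewrite (_ : J = set0); first exact: connected0.
by apply/seteqP; split=> [[s| |]|] // Js; case: (nfin s).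
Qed.

End Connectedness.

(** * Chains of subspaces *)

Section SubspaceChain.
Context {K : fieldType} {V : vectType K}.
Implicit Types (F : set {vspace V}) (U W : {vspace V}).

(** In a chain a subspace is determined by its dimension, so listing the
dimensions that occur, in increasing order, lists the chain. *)
Lemma subspace_chain_enum F : (0 < \dim {:V})%N -> F 0%VS -> F fullv ->
  (forall U W, F U -> F W -> (U <= W)%VS \/ (W <= U)%VS) ->
  exists (k : nat) (S : nat -> {vspace V}),
    [/\ (1 <= k <= \dim {:V})%N, S 0%N = 0%VS, S k = fullv,
        forall i, (i < k)%N -> (S i <= S i.+1)%VS /\ S i <> S i.+1 &
        forall U, F U <-> exists2 i, (i <= k)%N & U = S i].
Proof.
move=> dim_gt0 F0 Ffull chain; set n : nat := \dim {:V} in dim_gt0 *.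
have incl U W : F U -> F W -> (\dim U <= \dim W)%N -> (U <= W)%VS.
  move=> FU FW le; have [//|WU] := chain _ _ FU FW.
  by have /eqP -> : (W == U)%VS by rewrite eqEdim WU le.
have inj U W : F U -> F W -> \dim U = \dim W -> U = W.
  by move=> FU FW e; apply/eqP; rewrite eqEsubv !incl ?e.
pose P (m : nat) := `[< exists2 U, F U & \dim U = m >].
pose l := [seq m <- iota 0 n.+1 | P m].
have P0 : P 0%N by apply/asboolP; exists 0%VS; rewrite ?dimv0.
have Pn : P n by apply/asboolP; exists fullv.
have lE : l = rcons ([seq m <- iota 0 n | P m]) n.
  by rewrite /l -addn1 iotaD filter_cat /= add0n Pn cats1.
set k := size ([seq m <- iota 0 n | P m]) in lE *.
have sl : size l = k.+1 by rewrite lE size_rcons.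
have l0 : nth 0%N l 0 = 0%N by rewrite /l /= P0.
have lk : nth 0%N l k = n by rewrite lE nth_rcons ltnn eqxx.
have memP i : (i <= k)%N -> exists U, F U /\ \dim U = nth 0%N l i.
  move=> ik; have : nth 0%N l i \in l by rewrite mem_nth// sl.
  by rewrite mem_filter => /andP[/asboolP[U FU dU] _]; exists U.
pose S i := match pselect (exists U, F U /\ \dim U = nth 0%N l i) with
            | left h => projT1 (cid h) | right _ => 0%VS end.
have SP i : (i <= k)%N -> F (S i) /\ \dim (S i) = nth 0%N l i.
  by move=> /memP h; rewrite /S; case: pselect => // h'; case: cid.
have incr i : (i < k)%N -> (nth 0%N l i < nth 0%N l i.+1)%N.
  move=> ik; have : sorted ltn l.
    by rewrite sorted_filter ?iota_ltn_sorted//; exact: ltn_trans.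
  by move=> /(sortedP 0%N); apply; rewrite sl ltnS.
exists k, S; split.
- apply/andP; split; last first.
    by rewrite /k size_filter (leq_trans (count_size _ _))// size_iota.
  by rewrite lt0n; apply: contraTneq dim_gt0 => k0; rewrite -lk k0 l0.
- have [F1 d1] := SP 0%N (leq0n _); apply: inj => //.
  by rewrite d1 l0 dimv0.
- by have [F1 d1] := SP k (leqnn _); apply: inj => //; rewrite d1 lk.
- move=> i ik; have [F1 d1] := SP i (ltnW ik); have [F2 d2] := SP i.+1 ik.
  have lt := incr i ik; split.
    by apply: incl => //; rewrite d1 d2 ltnW.
  by move=> e; move: lt; rewrite -d1 -d2 e ltnn.
- move=> U; split=> [FU|[i ik ->]]; last by have [] := SP i ik.
  have Ul : \dim U \in l.
    rewrite mem_filter; apply/andP; split; first by apply/asboolP; exists U.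
    by rewrite mem_iota add0n /= ltnS dimvS// subvf.
  have ik : (index (\dim U) l <= k)%N by rewrite -ltnS -sl index_mem.
  exists (index (\dim U) l) => //; have [F1 d1] := SP _ ik.
  by apply: inj => //; rewrite d1 nth_index.
Qed.

End SubspaceChain.

(** A subspace of maximal dimension among those contained in [P] is all of [P]:
otherwise a vector of [P] outside it would enlarge it. *)
Lemma vspace_of_closed_pred (K : fieldType) (V : vectType K) (P : V -> Prop) :
  P 0 -> (forall a u v, P u -> P v -> P (a *: u + v)) ->
  exists S : {vspace V}, forall v, v \in S <-> P v.
Proof.
move=> P0 Plin.
pose Q n := `[< exists2 S : {vspace V}, (forall v, v \in S -> P v) & \dim S = n >].
have Q0 : exists n, Q n.
  exists 0%N; apply/asboolP; exists 0%VS; last exact: dimv0.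
  by move=> v; rewrite memv0 => /eqP ->.
have Qub n : Q n -> (n <= \dim {:V})%N.
  by move=> /asboolP[S _ <-]; apply: dimvS; exact: subvf.
have [n /asboolP[S SP dS] nmax] := ex_maxnP Q0 Qub.
exists S => v; split=> [/SP//|Pv].
have : Q (\dim (S + <[v]>)%VS).
  apply/asboolP; exists (S + <[v]>)%VS => // _ /memv_addP[u uS [_ /vlineP[a ->] ->]].
  by rewrite addrC; apply: Plin => //; exact: SP.
move=> /nmax; rewrite -dS => le.
have /eqP -> : (S == S + <[v]>)%VS by rewrite eqEdim addvSl.
by rewrite memvE addvSr.
Qed.

(** * From interval-valued spectra to a filtration *)

Section SpectralFiltration.
Context {R : realType} {V : vectType R}.
(* The argument only uses that each vector carries a nonempty interval and that
   a real number missed by all of them cuts out a subspace. *)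
Variable Sig : V -> set (\bar R).
Hypothesis Sig_nonempty : forall v, v != 0 -> Sig v !=set0.
Hypothesis Sig_interval : forall v, v != 0 -> is_ereal_interval (Sig v).
Let Sigma := \bigcup_(v in [set v : V | v != 0]) Sig v.
Hypothesis gap_subspace : forall lam : R, ~ Sigma lam%:E ->
  exists S : {vspace V}, forall v, v != 0 ->
    (v \in S <-> Sig v `<=` [set x | (x < lam%:E)%E]).
Hypothesis dim_gt0 : (0 < \dim {:V})%N.

Let below (lam : R) (S : {vspace V}) := ~ Sigma lam%:E /\
  forall v, v != 0 -> (v \in S <-> Sig v `<=` [set x | (x < lam%:E)%E]).

Let below_sub lam mu S T : below lam S -> below mu T -> lam <= mu ->
  (S <= T)%VS.
Proof.
move=> [_ HS] [_ HT] lm; apply/subvP => v vS.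
have [->|v0] := eqVneq v 0; first exact: mem0v.
apply/(HT v v0) => x /((HS v v0).1 vS) /= xl.
by apply: lt_le_trans xl _; rewrite lee_fin.
Qed.

Let above lam S v : below lam S -> v \notin S ->
  Sig v `<=` [set x | (lam%:E < x)%E].
Proof.
move=> [nl HS] vS.
have v0 : v != 0 by apply: contraNneq vS => ->; exact: mem0v.
have nlv : ~ Sig v lam%:E by move=> h; apply: nl; exists v.
move=> y Sy /=; rewrite ltNge; apply/negP => yl.
move/negP: vS; apply; apply/(HS v v0) => x Sx /=.
rewrite ltNge; apply/negP => lx; apply: nlv.
by apply: (Sig_interval v0 Sy Sx); rewrite yl lx.
Qed.

(** The chain is made of 0, the whole space and all subspaces cut out by real
numbers outside [Sigma]; [I i] collects the intervals of the vectors that enter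
at its [i]-th step. *)
Lemma spectral_filtration :
  exists (k : nat) (I : nat -> set (\bar R)),
    [/\ (1 <= k <= \dim {:V})%N, ordered_components Sigma k I,
        forall i, (1 < i < k)%N -> ereal_bounded (I i) &
        exists S : nat -> {vspace V},
          [/\ S 0%N = 0%VS,
              forall i, (i < k)%N -> (S i <= S i.+1)%VS /\ S i <> S i.+1,
              S k = fullv &
              forall i, (1 <= i <= k)%N ->
                [set v | v \in S i /\ v != 0] =
                [set v | v != 0 /\
                  Sig v `<=` \bigcup_(j in [set j | (1 <= j <= i)%N]) I j]]].
Proof.
pose F : set {vspace V} :=
  [set S | [\/ S = 0%VS, S = fullv | exists lam, below lam S]].
have F0 : F 0%VS by constructor 1.
have Ffull : F fullv by constructor 2.
have chain U W : F U -> F W -> (U <= W)%VS \/ (W <= U)%VS.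
  case=> [->|->|[lam HU]] [->|->|[mu HW]]; rewrite ?sub0v ?subvf; try by [left|right].
  have [lm|/ltW ml] := leP lam mu; [left|right].
    exact: below_sub HU HW lm.
  exact: below_sub HW HU ml.
have [k [S [k_range S0 Sk Sincr SF]]] :=
  subspace_chain_enum dim_gt0 F0 Ffull chain.
have Smono i j : (i <= j <= k)%N -> (S i <= S j)%VS.
  elim: j => [|j IH]; first by case/andP; rewrite leqn0 => /eqP ->.
  rewrite leq_eqVlt => /andP[/orP[/eqP -> //|ij] jk].
  by apply: subv_trans (IH _) (Sincr _ jk).1; rewrite -ltnS ij ltnW.
have gap i : (1 <= i < k)%N -> exists lam, below lam (S i).
  move=> /andP[i1 ik]; have : F (S i) by apply/SF; exists i => //; exact: ltnW.
  case=> [e|e|//].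
    have [|le ne] := Sincr i.-1; first by rewrite prednK// ltnW.
    rewrite prednK// in le ne.
    by case: ne; apply/eqP; rewrite eqEsubv le /= e sub0v.
  have [le ne] := Sincr i ik.
  by case: ne; apply/eqP; rewrite eqEsubv le e subvf.
pose I i := \bigcup_(v in [set v | v \in S i /\ v \notin S i.-1]) Sig v.
have nz i v : v \notin S i -> v != 0.
  by move=> h; apply: contraNneq h => ->; exact: mem0v.
(* each nonzero vector enters the chain at exactly one step *)
have layer v : v != 0 -> exists2 i, (1 <= i <= k)%N & v \in S i /\ v \notin S i.-1.
  move=> v0; have ex : exists i, v \in S i by exists k; rewrite Sk memvf.
  have vm := ex_minnP ex; case: vm => m vm mmin; exists m; last first.
    split=> //; apply/negP => /mmin; rewrite leqNgt.
    case: m vm {mmin} => [|m] vm; last by rewrite ltnS leqnn.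
    by move: vm; rewrite S0 memv0 (negPf v0).
  rewrite mmin ?Sk ?memvf// andbT lt0n.
  by apply: contraNneq v0 => m0; move: vm; rewrite m0 S0 memv0.
have lt_pred_le i j : (i < j)%N -> (i <= j.-1)%N by case: j.
have sep i j : (1 <= i)%N -> (i < j)%N -> (j <= k)%N -> exists lam,
    [/\ ~ Sigma lam%:E, I i `<=` [set x | (x < lam%:E)%E] &
        I j `<=` [set x | (lam%:E < x)%E]].
  move=> i1 ij jk; have [|lam bl] := gap i; first by rewrite i1 (leq_trans ij).
  exists lam; split; first by case: bl.
    move=> x [v [vi vNi] Sx]; have v0 := nz _ _ vNi.
    exact: ((bl.2 v v0).1 vi).
  move=> x [v [vj vNj] Sx]; apply: above bl _ _ Sx.
  apply: contra vNj => /(subvP (Smono i j.-1 _)); apply.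
  by rewrite lt_pred_le//= (leq_trans (leq_pred _)).
have I_nonempty i : (1 <= i <= k)%N -> I i !=set0.
  move=> /andP[i1 ik]; have [|le ne] := Sincr i.-1; first by rewrite prednK.
  rewrite prednK// in le ne.
  have [v vi vNi] : exists2 v, v \in S i & v \notin S i.-1.
    by apply/subvPn; apply/negP => h; apply: ne; apply/eqP; rewrite eqEsubv le.
  by have [x Sx] := Sig_nonempty (nz _ _ vNi); exists x, v.
have SigmaE : Sigma = \bigcup_(i in [set i | (1 <= i <= k)%N]) I i.
  apply/seteqP; split=> x.
    by move=> [v /= v0 Sx]; have [i ik vi] := layer v v0; exists i => //; exists v.
  by move=> [i /= ik [v [_ vN] Sx]]; exists v => //; exact: nz vN.
have I_sub i : (1 <= i <= k)%N -> I i `<=` Sigma.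
  by move=> ik x Ix; rewrite SigmaE; exists i.
have disj i j x : (1 <= i <= k)%N -> (1 <= j <= k)%N -> I i x -> I j x -> i = j.
  move=> /andP[i1 ik] /andP[j1 jk] Iix Ijx.
  have [ij|ji|//] := ltngtP i j; exfalso.
    have [lam [_ h1 h2]] := sep i j i1 ij jk.
    by have := lt_trans (h1 _ Iix) (h2 _ Ijx); rewrite ltxx.
  have [lam [_ h1 h2]] := sep j i j1 ji ik.
  by have := lt_trans (h1 _ Ijx) (h2 _ Iix); rewrite ltxx.
have I_interval i : (1 <= i <= k)%N -> is_ereal_interval (I i).
  move=> ik x y Ix Iy z /andP[xz zy]; apply: contrapT => nIz.
  have [i1 ilek] := andP ik.
  have [Sz|nSz] := pselect (Sigma z).
    move: Sz; rewrite SigmaE => -[j /= jk Ijz].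
    have [j1 jlek] := andP jk.
    have [ij|ji|ije] := ltngtP i j; last by apply: nIz; rewrite ije.
      have [lam [_ h1 h2]] := sep i j i1 ij jlek.
      by have := lt_le_trans (lt_trans (h1 _ Iy) (h2 _ Ijz)) zy; rewrite ltxx.
    have [lam [_ h1 h2]] := sep j i j1 ji ilek.
    by have := le_lt_trans xz (lt_trans (h1 _ Ijz) (h2 _ Ix)); rewrite ltxx.
  have {}xz : (x < z)%E.
    by rewrite lt_neqAle xz andbT; apply: contra_notN nIz => /eqP <-.
  have {}zy : (z < y)%E.
    by rewrite lt_neqAle zy andbT; apply: contra_notN nIz => /eqP ->.
  case: z xz zy nSz {nIz} => [lam xz zy nSz|_|]; last 2 first.
  - by rewrite ltNge leey.
  - by rewrite ltNge leNye.
  (* z splits the layer: T contains v but not w, and no member of the chain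
     separates two vectors entering at the same step *)
  have [T HT] := gap_subspace nSz; have bT : below lam T by split.
  have /SF[j jk Tj] : F T by constructor 3; exists lam.
  case: Ix => v [vi vNi] Sx; case: Iy => w [wi wNi] Sy.
  have vT : v \in T.
    apply: contrapT => /negP/(above bT)/(_ _ Sx) /=.
    by rewrite ltNge (ltW xz).
  have wT : w \notin T.
    apply/negP => /(HT _ (nz _ _ wNi))/(_ _ Sy) /=.
    by rewrite ltNge (ltW zy).
  have [ij|ji] := leqP i j.
    move/negP: wT; apply; rewrite Tj; apply: subvP wi.
    by apply: Smono; rewrite ij.
  move/negP: vNi; apply; move: vT; rewrite Tj; apply: subvP.
  by apply: Smono; rewrite lt_pred_le//= (leq_trans (leq_pred _)).
have compE i x : (1 <= i <= k)%N -> I i x -> connected_component Sigma x = I i.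
  move=> ik Ix; apply/seteqP; split; last first.
    apply: connected_component_max => //; first exact: I_sub.
    by apply: ereal_interval_connected; exact: I_interval.
  move=> y Cy; have Sy := connected_component_sub Cy.
  have Cx : connected_component Sigma x x.
    by apply: connected_component_refl; exact: I_sub Ix.
  have iC := connected_ereal_interval (@component_connected _ Sigma x).
  move: Sy; rewrite {1}SigmaE => -[j /= jk Ijy].
  have [i1 ilek] := andP ik; have [j1 jlek] := andP jk.
  have [ij|ji|-> //] := ltngtP i j; exfalso.
    have [lam [nl h1 h2]] := sep i j i1 ij jlek; apply: nl.
    apply: (@connected_component_sub _ _ x); apply: (iC _ _ Cx Cy).
    by apply/andP; split; apply: ltW; [exact: h1|exact: h2].
  have [lam [nl h1 h2]] := sep j i j1 ji ilek; apply: nl.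
  apply: (@connected_component_sub _ _ x); apply: (iC _ _ Cy Cx).
  by apply/andP; split; apply: ltW; [exact: h1|exact: h2].
exists k, I; split=> //.
- split=> //.
  + by move=> i ik; split; [exact: I_nonempty|exact: I_interval].
  + move=> i /andP[i1 ik] x y Ix Iy; have [lam [_ h1 h2]] := sep i i.+1 i1 (leqnn _) ik.
    exact: lt_trans (h1 _ Ix) (h2 _ Iy).
  + apply/seteqP; split=> [_ [x Sx <-]|_ [i ik <-]].
      move: Sx; rewrite {1}SigmaE => -[i ik Ix].
      by exists i => //; rewrite (compE i).
    have [x Ix] := I_nonempty i ik; exists x; first exact: I_sub Ix.
    exact: compE.
- move=> i /andP[i1 ik].
  have ip : (1 <= i.-1)%N by exact: lt_pred_le.
  have ipi : (i.-1 < i)%N by rewrite prednK// (ltnW i1).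
  have [lam [_ _ lo]] := sep i.-1 i ip ipi (ltnW ik).
  have [mu [_ hi _]] := sep i i.+1 (ltnW i1) (leqnn _) ik.
  exists [set r | lam <= r <= mu].
    rewrite /bounded_set; exists (Num.max `|lam| `|mu|); split; first exact: num_real.
    move=> M; rewrite gt_max => /andP[lM mM] r /= /andP[lr rm].
    have := ler_norm mu; have := ler_norm (- lam); rewrite normrN.
    by rewrite ler_norml => ? ?; apply/andP; split; lra.
  move=> x Ix; move: (lo x Ix) (hi x Ix) => /=.
  case: x Ix => [r _|_|_]; rewrite ?lte_fin.
  + by move=> lr rm; exists r => //=; rewrite !ltW.
  + by rewrite [X in _ -> is_true X -> _]ltNge leey.
  + by rewrite ltNge leNye.
- exists S; split=> // i /andP[i1 ik]; apply/seteqP; split=> v /=.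
    move=> [vi v0]; split=> // x Sx.
    have [j /andP[j1 jk] [vj vNj]] := layer v v0.
    exists j; last by exists v.
    rewrite /= j1 /= leqNgt; apply/negP => ij.
    move/negP: vNj; apply; apply: subvP vi; apply: Smono.
    by rewrite lt_pred_le//= (leq_trans (leq_pred _)).
  move=> [v0 H]; split=> //.
  have [j jk [vj vNj]] := layer v v0; have [j1 jlek] := andP jk.
  have [x Sx] := Sig_nonempty v0.
  have [l /= /andP[l1 li] Ilx] := H x Sx.
  have jl : j = l.
    apply: (disj j l x) => //; first by rewrite l1 (leq_trans li).
    by exists v.
  by apply: subvP vj; apply: Smono; rewrite jl li.
Qed.

End SpectralFiltration.

(** * The spectrum of a flow whose nonzero solutions never vanish *)

Section FlowSpectrum.
Context {R : realType} {d : nat}.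
Variable X : R -> 'M[R]_d.
Hypothesis d_gt0 : (1 <= d)%N.
(* Clipping the time at 0 gives functions continuous on all of R, so that
   one-sided continuity at 0 never has to be mentioned. *)
Hypothesis X_cont : forall xi : 'cV[R]_d,
  continuous (fun t : R => `|X (Num.max 0 t) *m xi|).
Hypothesis X_inj : forall (t : R) (xi : 'cV[R]_d),
  0 <= t -> xi != 0 -> X t *m xi != 0.

Let phi (xi : 'cV[R]_d) (t : R) := ln `|X (Num.max 0 t) *m xi|.

Let norm_gt0 (xi : 'cV[R]_d) (t : R) : xi != 0 -> 0 <= t -> 0 < `|X t *m xi|.
Proof. by move=> xi0 t0; rewrite normr_gt0 X_inj. Qed.

Let phi_cont xi : xi != 0 -> continuous (phi xi).
Proof.
move=> xi0 t.
apply: (continuous_comp (f := fun t : R => `|X (Num.max 0 t) *m xi|)).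
  exact: X_cont.
by apply: continuous_ln; rewrite norm_gt0// le_max lexx.
Qed.

Lemma solution_bohl_spectrumE xi : xi != 0 ->
  solution_bohl_spectrum X xi = slope_spectrum (phi xi).
Proof.
move=> xi0.
have E (t s : nat -> R) : (forall n, 0 <= t n /\ 0 <= s n) ->
    (fun n => ((t n - s n)^-1 *
      ln (`|X (t n) *m xi| / `|X (s n) *m xi|))%:E) =
    (fun n => (slope (phi xi) (t n) (s n))%:E).
  move=> h; apply/funext => n; have [t0 s0] := h n.
  by rewrite /slope /phi !max_r// ln_div// posrE norm_gt0.
apply/seteqP; split=> x [t [s [h0 h1 h2]]]; exists t, s; split=> //.
  by rewrite -E.
by rewrite E.
Qed.

Lemma flow_spectral_filtration :
  exists (k : nat) (I : nat -> set (\bar R)),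
    [/\ (1 <= k <= d)%N, ordered_components (bohl_spectrum X) k I,
        forall i, (1 < i < k)%N -> ereal_bounded (I i) &
        exists S : nat -> {vspace 'cV[R]_d},
          [/\ S 0%N = 0%VS,
              forall i, (i < k)%N -> (S i <= S i.+1)%VS /\ S i <> S i.+1,
              S k = fullv &
              forall i, (1 <= i <= k)%N ->
                [set xi | xi \in S i /\ xi != 0] =
                [set xi : 'cV[R]_d | xi != 0 /\
                  solution_bohl_spectrum X xi `<=`
                    \bigcup_(j in [set j | (1 <= j <= i)%N]) I j]]].
Proof.
have dimE : \dim {: 'cV[R]_d} = d by rewrite dimvf /dim /= muln1.
have := @spectral_filtration _ _ (fun xi => solution_bohl_spectrum X xi).
rewrite dimE; apply=> //.
- by move=> v v0; rewrite solution_bohl_spectrumE//; exact: slope_spectrum_nonempty.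
- move=> v v0; rewrite solution_bohl_spectrumE//.
  by apply: slope_spectrum_interval; exact: phi_cont.
- move=> lam nlam.
  pose P (xi : 'cV[R]_d) :=
    exists C, forall t, 0 <= t -> `|X t *m xi| <= C * expR (lam * t).
  have [||S SP] := @vspace_of_closed_pred _ _ P.
  + by exists 0 => t _; rewrite mulmx0 normr0 mul0r.
  + move=> a u v [C1 H1] [C2 H2]; exists (`|a| * C1 + C2) => t t0.
    rewrite mulmxDr -scalemxAr (le_trans (ler_normD _ _))// mulrDl lerD ?H2//.
    by rewrite normrZ -mulrA ler_wpM2l// H1.
  exists S => xi xi0; rewrite SP solution_bohl_spectrumE//.
  rewrite -slope_spectrum_below; [|exact: phi_cont|]; last first.
    by rewrite -solution_bohl_spectrumE// => h; apply: nlam; exists xi.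
  split=> [[C HC]|[M HM]].
    exists (ln C) => t t0; rewrite /phi max_r//.
    have C0 : 0 < C.
      have := HC 0 (lexx _); rewrite mulr0 expR0 mulr1; apply: lt_le_trans.
      exact: norm_gt0.
    rewrite -[X in _ + X]expRK -lnM ?posrE ?expR_gt0//.
    by rewrite ler_ln ?posrE ?mulr_gt0 ?expR_gt0 ?norm_gt0 ?HC.
  exists (expR M) => t t0; have := HM t t0; rewrite /phi max_r//.
  by rewrite -expRD -ler_expR lnK// posrE norm_gt0.
Qed.

End FlowSpectrum.

(** * Increments of absolutely continuous functions *)

Section AbsolutelyContinuous.
Context {R : realType}.
Notation outer_measure := ((@wlength R idfun)^*)%mu.

(** Continuous induction, which replaces tagged partitions subordinate to a
gauge in the proof of [ac_increment_le]. *)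
Lemma segment_induction (P : R -> Prop) (a b : R) : a <= b -> P a ->
  (forall c, a <= c <= b -> exists2 h, 0 < h &
     forall x y, a <= x -> x <= c -> c <= y -> y <= b -> y - x < h ->
       P x -> P y) ->
  P b.
Proof.
move=> ab Pa step.
pose E := [set x | a <= x <= b /\ P x].
have Ea : E a by split; rewrite ?lexx.
have Eub : ubound E b by move=> x [/andP[]].
have hsE : has_sup E by split; [exists a|exists b].
pose c := sup E.
have acb : a <= c <= b by rewrite ub_le_sup//= ?ge_sup//; [exists a|exists b].
have [h h0 hstep] := step c acb.
have [x Ex cx] := sup_adherent h0 hsE.
have [/andP[ax xb] Px] := Ex.
have xc : x <= c by apply: ub_le_sup => //; exists b.
have /andP[ac cb] := acb.
pose y := Num.min b (c + (h - (c - x)) / 2).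
have xlt : 0 < h - (c - x) by rewrite /c in cx *; lra.
have cy : c <= y by rewrite le_min cb /=; lra.
have yb : y <= b by rewrite ge_min lexx.
have yx : y - x < h.
  have : y <= c + (h - (c - x)) / 2 by rewrite ge_min lexx orbT.
  lra.
have Py := hstep x y ax xc cy yb yx Px.
have : y <= c.
  by apply: ub_le_sup; [exists b|split=> //; rewrite yb (le_trans ac)].
rewrite {1}/y ge_min => /orP[bc|]; last by lra.
by have -> : b = y by apply/eqP; rewrite eq_le yb (le_trans bc cy).
Qed.

Lemma sum_length_le_measure n (u v : 'I_n -> R) (U : set R) :
  open U -> (forall k, u k < v k) -> trivIset setT (fun k => `]u k, v k[%classic) ->
  (forall k, `]u k, v k[%classic `<=` U) ->
  ((\sum_(k < n) (v k - u k))%:E <= lebesgue_measure U)%E.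
Proof.
move=> oU uv tuv uvU.
have mI (k : 'I_n) : measurable (`]u k, v k[%classic : set R).
  exact: measurable_itv.
rewrite -sumEFin [leLHS](_ : _ =
    lebesgue_measure (\big[setU/set0]_(k < n) `]u k, v k[%classic : set R)).
  apply: le_measure; rewrite ?inE.
  - by apply: bigsetU_measurable => k _.
  - exact: open_measurable.
  - apply: (big_ind (fun A : set R => A `<=` U)) => //.
    by move=> A B AU BU; rewrite subUset.
rewrite measure_semi_additive_ord//; last exact: bigsetU_measurable.
apply: eq_bigr => k _; have := lebesgue_measure_itv `]u k, v k[.
by rewrite /= lte_fin uv => /esym.
Qed.

(** Mean value inequality off a null set.  Cover the null set [N] by an open set
[U] of measure less than the delta that absolute continuity assigns to [e].
Walking from [a] to [b] by short steps, a step around a point outside [N] costs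
at most the increment of [G]; a step around a point of [N] can be taken inside
[U], and all such steps together cost less than [e]. *)
Lemma ac_increment_le (V : normedModType R) (f : R -> V) (G : R -> R)
    (N : set R) (a b : R) : a <= b ->
  absolutely_continuous_on a b f -> (outer_measure N = 0)%E ->
  (forall x y, a <= x -> x <= y -> y <= b -> G x <= G y) ->
  (forall t, a <= t <= b -> ~ N t -> exists2 h, 0 < h &
     forall x y, a <= x -> x <= t -> t <= y -> y <= b -> y - x < h ->
       `|f y - f x| <= G y - G x) ->
  `|f b - f a| <= G b - G a.
Proof.
move=> ab acf N0 Gmono loc; apply/ler_addgt0Pr => e e0.
have [del del0 acdel] := acf e e0.
have d20 : 0 < del / 2 by rewrite divr_gt0.
have [U [oU NU mU]] := outer_measure_open_le N d20.
have {}mU : (lebesgue_measure U < del%:E)%E.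
  apply: le_lt_trans mU _; rewrite N0 add0e lte_fin; lra.
(* the steps taken inside U before reaching x, listed from left to right *)
pose adm (n : nat) (u v : nat -> R) (x : R) :=
  [/\ forall k, (k < n)%N -> [/\ a <= u k, u k < v k & v k <= x],
      forall j k, (j < k)%N -> (k < n)%N -> v j <= u k &
      forall k, (k < n)%N -> `]u k, v k[%classic `<=` U].
pose P x := exists n u v, adm n u v x /\
  `|f x - f a| <= G x - G a + \sum_(k < n) `|f (v k) - f (u k)|.
have [n [u [v [[h1 h2 h3] h4]]]] : P b.
  apply: (@segment_induction P a b ab).
    exists 0%N, (fun=> 0), (fun=> 0); split; last first.
      by rewrite big_ord0 !subrr normr0 addr0.
    by split.
  move=> c acb.
  have [Nc|nNc] := pselect (N c); last first.
    have [h h0 hloc] := loc c acb nNc; exists h => // x y ax xc cy yb yxh.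
    move=> [n [u [v [[h1 h2 h3] h4]]]]; exists n, u, v; split.
      split=> // k kn; have [? ? vx] := h1 k kn; split=> //.
      exact: le_trans vx (le_trans xc cy).
    rewrite -(subrKA (f x)) (le_trans (ler_normD _ _))//.
    have := hloc x y ax xc cy yb yxh; move: h4; lra.
  have /nbhs_ballP[h /= h0 hU] := open_nbhs_nbhs (conj oU (NU _ Nc)).
  exists h => // x y ax xc cy yb yxh [n [u [v [[h1 h2 h3] h4]]]].
  have [xy|] := ltP x y; last first.
    move=> yx; have <- : x = y by apply/eqP; rewrite eq_le yx (le_trans xc cy).
    by exists n, u, v.
  pose u' k := if k == n then x else u k; pose v' k := if k == n then y else v k.
  exists n.+1, u', v'; split; last first.
    rewrite big_ord_recr /= {2}/u' {2}/v' eqxx.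
    have -> : \sum_(i < n) `|f (v' i) - f (u' i)| = \sum_(i < n) `|f (v i) - f (u i)|.
      by apply: eq_bigr => i _; rewrite /u' /v' ltn_eqF.
    rewrite -(subrKA (f x)) (le_trans (ler_normD _ _))//.
    have := Gmono x y ax (ltW xy) yb; move: h4; lra.
  split.
  - move=> k; rewrite ltnS leq_eqVlt /u' /v' => /orP[/eqP ->|kn].
      by rewrite eqxx.
    rewrite ltn_eqF//; have [? ? vx] := h1 k kn; split=> //.
    exact: le_trans vx (ltW xy).
  - move=> j k jk; rewrite ltnS leq_eqVlt /u' /v' => /orP[/eqP kn|kn].
      by rewrite kn eqxx ltn_eqF -?kn//; have [] := h1 j; rewrite -?kn.
    by rewrite !ltn_eqF ?(ltn_trans jk)// h2.
  - move=> k; rewrite ltnS leq_eqVlt /u' /v' => /orP[/eqP ->|kn].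
      rewrite eqxx => z /=; rewrite in_itv/= => /andP[xz zy]; apply: hU => /=.
      by rewrite /ball /= ltr_norml; apply/andP; split; lra.
    by rewrite ltn_eqF//; exact: h3.
apply: le_trans h4 _; rewrite lerD2l ltW//.
have tI : trivIset setT (fun k : 'I_n => `]u k, v k[%classic).
  move=> i j _ _ [z [/=]]; rewrite !in_itv/= => /andP[zi1 zi2] /andP[zj1 zj2].
  apply/val_inj => /=; have [ij|ji|//] := ltngtP i j.
    by have := lt_trans (le_lt_trans (h2 i j ij (ltn_ord j)) zj1) zi2; rewrite ltxx.
  by have := lt_trans (le_lt_trans (h2 j i ji (ltn_ord i)) zi1) zj2; rewrite ltxx.
apply: (acdel n (fun k => u k) (fun k => v k)) => //.
  by move=> k; have [] := h1 k (ltn_ord k).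
rewrite -lte_fin; apply: le_lt_trans mU.
apply: sum_length_le_measure => // k; first by have [] := h1 k (ltn_ord k).
exact: h3.
Qed.

Lemma ac_norm_continuous (V : normedModType R) (f : R -> V) :
  (forall b, 0 < b -> absolutely_continuous_on 0 b f) ->
  continuous (fun t : R => `|f (Num.max 0 t)|).
Proof.
move=> acf t; apply/cvgrPdist_lt => e e0.
pose b := Num.max 0 t + 1.
have b0 : 0 < b by rewrite /b ltr_wpDl// le_max lexx.
have [del del0 hdel] := acf b b0 e e0.
have key x y : 0 <= x -> x <= y -> y <= b -> y - x < del -> `|f y - f x| < e.
  move=> x0; rewrite le_eqVlt => /orP[/eqP ->|xy] yb yxd.
    by rewrite subrr normr0.
  have := hdel 1%N (fun=> x) (fun=> y); rewrite !big_ord1; apply => //.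
  by move=> i j _ _ _; rewrite !ord1.
have m0 : 0 < Num.min del 1 by rewrite lt_min del0 ltr01.
have tnear : nbhs t (ball t (Num.min del 1)) by exact: nbhsx_ballx.
near=> s.
have st : `|t - s| < Num.min del 1.
  by near: s; exact: tnear.
move: st; rewrite lt_min => /andP[sd s1].
have maxd : `|Num.max 0 t - Num.max 0 s| <= `|t - s|.
  rewrite /Num.max; case: ltP => ?; case: ltP => ?; rewrite ?subrr ?normr0//.
  - by rewrite !ger0_norm; lra.
  - by rewrite !ler0_norm; lra.
apply: (@le_lt_trans _ _ `|f (Num.max 0 t) - f (Num.max 0 s)|).
  exact: ler_dist_dist.
have sb : Num.max 0 s <= b.
  by move: maxd; rewrite /b ler_distl => /andP[]; lra.
have tb : Num.max 0 t <= b by rewrite /b; lra.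
have [ts|st] := leP (Num.max 0 t) (Num.max 0 s).
  rewrite distrC; apply: key => //; first by rewrite le_max lexx.
  by apply: le_lt_trans sd; apply: le_trans maxd; rewrite distrC ler_norm.
apply: key => //; [by rewrite le_max lexx|exact: ltW|].
by apply: le_lt_trans sd; apply: le_trans maxd; rewrite ler_norm.
Unshelve. all: by end_near. Qed.

(** Differentiability at [t] controls the increments over intervals that contain
[t], not only those starting at [t]. *)
Lemma is_derive_straddle (V : normedModType R) (f : R -> V) (t : R) (D : V) (e : R) :
  is_derive t (1 : R) f D -> 0 < e -> exists2 h, 0 < h &
    forall x y, x <= t -> t <= y -> y - x < h ->
      `|f y - f x - (y - x) *: D| <= e * (y - x).
Proof.
move=> fD e0.
have cv : h^-1 *: (f (h + t) - f t) @[h --> 0^'] --> D.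
  have := @ex_derive _ _ _ _ _ _ _ fD; rewrite /derivable => /= cvf.
  rewrite -(@derive_val _ _ _ _ _ _ _ fD); move: cvf; rewrite /derive.
  by under eq_fun do rewrite [_ *: 1]mulr1.
move/cvgrPdist_le: cv => /(_ e e0)[h /= h0 hh].
have one z : `|z| < h -> `|f (z + t) - f t - z *: D| <= e * `|z|.
  move=> zh; have [->|z0] := eqVneq z 0.
    by rewrite add0r subrr scale0r subr0 !normr0 mulr0.
  have := hh z; rewrite /ball /= sub0r normrN => /(_ zh z0) le.
  have -> : f (z + t) - f t - z *: D = - (z *: (D - z^-1 *: (f (z + t) - f t))).
    by rewrite scalerBr scalerA divff// scale1r opprB.
  by rewrite normrN normrZ mulrC ler_wpM2r.
exists h => // x y xt ty yxh.
have := one (y - t); have := one (x - t); rewrite !subrK.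
rewrite ler0_norm; last by lra.
rewrite ger0_norm; last by lra.
move=> /(_ ltac:(lra)) lx /(_ ltac:(lra)) ly.
have -> : f y - f x - (y - x) *: D =
    (f y - f t - (y - t) *: D) - (f x - f t - (x - t) *: D).
  have -> : y - x = (y - t) - (x - t) by ring.
  rewrite scalerBl; move: (_ *: D) (_ *: D) => p q.
  by rewrite [in RHS]opprD [RHS]addrACA -opprD (opprB (f x)) subrKA.
by apply: le_trans (ler_normB _ _) _; lra.
Qed.

End AbsolutelyContinuous.

(** * A monotone majorant of an integral *)

Section Majorant.
Context {R : realType}.
Notation lambda := (@lebesgue_measure R).
Notation mu := (@completed_lebesgue_measure R).
Implicit Types (g : R -> R).

(** On the level set n <= g < n + 1 the integrand [g + 2] is at least n + 2. *)
Lemma weighted_level_sets_le_integral g (D : set (lebesgueType R)) :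
  measurable D -> (forall t, D t -> 0 <= g t) ->
  @measurable_fun _ _ (lebesgueType R) R D g ->
  (\sum_(0 <= n <oo)
     n.+2%:R%:E * mu (D `&` g @^-1` `[n%:R, n.+1%:R[%classic) <=
   \int[mu]_(t in D) (g t + 2)%:E)%E.
Proof.
move=> mD g0 mg; set E := fun n => D `&` g @^-1` `[n%:R, n.+1%:R[%classic.
have mE n : measurable (E n : set (lebesgueType R)).
  by apply: mg => //; exact: measurable_itv.
have DE : D = \bigcup_n E n.
  apply/seteqP; split=> [t Dt|t [n _ []]//].
  by exists (Num.trunc (g t)) => //; split=> //=; rewrite in_itv/= truncn_itv// g0.
have mg2 (B : set (lebesgueType R)) : B `<=` D ->
    measurable B -> measurable_fun B (fun t => (g t + 2)%:E).
  move=> BD mB; apply/measurable_EFinP; apply: measurable_funD.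
    exact: measurable_funS mg.
  exact: measurable_cst.
have g20 t : D t -> (0 <= (g t + 2)%:E)%E.
  by move=> Dt; rewrite lee_fin addr_ge0// g0.
have tE : trivIset setT E.
  move=> i j _ _ [t [[_ /=] + [_ /=]]]; rewrite !in_itv /=.
  by move=> /truncn_def <- /truncn_def <-.
rewrite [in leRHS]DE ge0_integral_bigcup//; last 2 first.
- by rewrite -DE; exact: mg2.
- by move=> t; rewrite -DE; exact: g20.
apply: lee_nneseries => n; first by move=> _ _; rewrite mule_ge0.
move=> _; rewrite -(integral_cst _ (mE n)); apply: ge0_le_integral => //.
- by move=> t _; rewrite lee_fin.
- by apply: mg2 => // t [].
- move=> t [Dt /=]; rewrite in_itv/= lee_fin => /andP[+ _].
  by rewrite -addn2 natrD lerD2r.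
Qed.

(** A substitute for the indefinite integral of [g] whose increments dominate
those of [g + 1] near every point, not just near Lebesgue points.  Enclose the
level set n <= g < n + 1 in an open set U_n of barely larger measure and let
[G x] be the sum over n of (n + 2) times the measure of the part of U_n to the
left of [x].  A short interval around a point of the n-th level set lies in U_n,
so [G] grows over it with slope at least n + 2 > g + 1. *)
Lemma integral_majorant g (T : R) : 0 <= T ->
  (forall t, 0 <= t <= T -> 0 <= g t) ->
  @measurable_fun _ _ (lebesgueType R) R (`[0, T]%classic : set R) g ->
  (\int[mu]_(t in (`[0%R, T]%classic : set R)) (g t)%:E < +oo)%E ->
  exists G : R -> R,
    (forall x y, x <= y -> G x <= G y) /\
    (forall t, 0 <= t <= T -> exists2 h, 0 < h &
       forall x y, x <= t -> t <= y -> y - x < h ->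
         (g t + 1) * (y - x) <= G y - G x).
Proof.
move=> T0 g0 mg intg; set D : set R := `[0, T]%classic.
have mD : measurable (D : set (lebesgueType R)).
  by apply: sub_caratheodory; exact: measurable_itv.
have muD : mu D = T%:E.
  have := lebesgue_measure_itv `[0, T]; rewrite /= lte_fin.
  have [T_gt0|T_le0] := ltP 0 T; first by rewrite sube0.
  move=> h; transitivity (0%:E : \bar R); first exact: h.
  by congr (_%:E); apply/eqP; rewrite eq_le T0 T_le0.
have D0 t : D t -> 0 <= g t by rewrite /D /= in_itv/=; exact: g0.
have total_lt : (\int[mu]_(t in D) (g t + 2)%:E < +oo)%E.
  rewrite [ltLHS](_ : _ = \int[mu]_(t in D) ((g t)%:E + cst 2%:E t))%E; last by [].
  rewrite ge0_integralD//.
  - rewrite integral_cst// lte_add_pinfty//.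
    have e : (2%:E * mu D)%E = (2 * T)%:E by rewrite muD EFinM.
    exact: (eq_ind_r (fun z => (z < +oo)%E) (ltry _) e).
  - exact/measurable_EFinP.
  - by move=> t _; rewrite lee_fin.
pose E n := D `&` g @^-1` `[n%:R, n.+1%:R[%classic.
(* the weights n + 2 times these tolerances sum to 1 *)
pose eps n : R := 1 / (2 ^ n.+1)%:R / n.+2%:R.
have eps0 n : 0 < eps n.
  by rewrite /eps divr_gt0// divr_gt0// ltr0n expn_gt0.
have /choice[U HU] n : exists U, [/\ open U, E n `<=` U &
    (lambda U <= mu (E n) + (eps n)%:E)%E].
  exact: (outer_measure_open_le (E n) (eps0 n)).
have oU n : open (U n) by case: (HU n).
have EU n : E n `<=` U n by case: (HU n).
have lU n : (lambda (U n) <= mu (E n) + (eps n)%:E)%E by case: (HU n).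
have mU n : measurable (U n) by exact: open_measurable.
pose nu (B : set R) : \bar R :=
  (\sum_(0 <= n <oo) n.+2%:R%:E * lambda (U n `&` B))%E.
have term0 n (B : set R) : (0 <= n.+2%:R%:E * lambda (U n `&` B))%E.
  by rewrite mule_ge0.
have nu_lt B : measurable B -> (nu B < +oo)%E.
  move=> mB; apply: (@le_lt_trans _ _ (\sum_(0 <= n <oo)
      (n.+2%:R%:E * mu (E n) + (1 / (2 ^ n.+1)%:R)%:E))%E).
    apply: lee_nneseries => [//|n _].
    apply: (@le_trans _ _ (n.+2%:R%:E * (mu (E n) + (eps n)%:E))%E).
      rewrite lee_wpmul2l//; apply: le_trans (lU n).
      apply: le_measure; rewrite ?inE; [|exact: mU|exact: subIsetl].
      by apply: measurableI; [exact: mU|exact: mB].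
    rewrite ge0_muleDr ?lee_fin ?(ltW (eps0 n))// leeD2l// -EFinM lee_fin.
    by rewrite /eps mulrC divfK// pnatr_eq0.
  apply: le_lt_trans (epsilon_trick _ _ _) _ => //; first by move=> n; rewrite mule_ge0.
  rewrite lte_add_pinfty ?ltry//; apply: le_lt_trans total_lt.
  exact: weighted_level_sets_le_integral.
have nu0 B : (0 <= nu B)%E by apply: nneseries_ge0.
have nu_fin B : measurable B -> nu B \is a fin_num.
  by move=> mB; rewrite ge0_fin_numE// nu_lt.
pose ray x : set R := `]-oo, x]%classic.
have mray x : measurable (ray x) by exact: measurable_itv.
pose G x := fine (nu (ray x)).
have mI x y : measurable (`]x, y]%classic : set R) by exact: measurable_itv.
have incr x y : x <= y -> G y - G x = fine (nu `]x, y]%classic).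
  move=> xy; have -> : G y = G x + fine (nu `]x, y]%classic).
    rewrite -fineD ?nu_fin//; congr fine.
    rewrite /nu -nneseriesD//; apply: eq_eseriesr => n _.
    rewrite -ge0_muleDr//; congr (_ * _)%E.
    rewrite -measureU ?measurableI//.
    - rewrite -setIUr; congr (lambda (_ `&` _)).
      by rewrite /ray (@itv_bndbnd_setU _ _ _ (BRight x)).
    - by apply: measurableI; [exact: mU|exact: mray].
    - by apply: measurableI; [exact: mU|exact: mI].
    - apply/seteqP; split=> // z [[_ zx] [_ zxy]].
      move: zx zxy; rewrite /ray /= !in_itv/= => zx /andP[].
      by rewrite ltNge zx.
  by rewrite addrC addKr.
exists G; split.
  by move=> x y xy; rewrite -subr_ge0 incr// fine_ge0.
move=> t tT; set m := Num.trunc (g t).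
have gt0 : 0 <= g t by exact: g0.
have Et : E m t by split=> //=; rewrite in_itv//= truncn_itv.
have /nbhs_ballP[h /= h0 hU] := open_nbhs_nbhs (conj (oU m) (EU m t Et)).
exists h => // x y xt ty yxh.
have xy : x <= y by exact: le_trans ty.
rewrite incr//.
have xyU : U m `&` `]x, y]%classic = `]x, y]%classic.
  apply/setIidPr => z /=; rewrite in_itv/= => /andP[xz zy]; apply: hU.
  by rewrite /ball /= ltr_norml; apply/andP; split; lra.
have lxy : lambda `]x, y]%classic = (y - x)%:E.
  have := lebesgue_measure_itv `]x, y]; rewrite /= lte_fin.
  case: ltP => [//|yx]; have -> : x = y by apply/eqP; rewrite eq_le xy yx.
  by rewrite subrr.
have : (m.+2%:R%:E * (y - x)%:E <= nu `]x, y]%classic)%E.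
  rewrite /nu (@nneseriesD1 _ _ m)// xyU lxy leeDl//.
  by apply: nneseries_ge0.
rewrite -EFinM -[X in (_ <= X)%E]fineK ?nu_fin// lee_fin; apply: le_trans.
rewrite ler_wpM2r ?subr_ge0//.
have /andP[_] := truncn_itv gt0.
by rewrite -/m -[m.+2]addn1 natrD => /ltW; rewrite lerD2r.
Qed.

End Majorant.

(** * Solutions of a linear Caratheodory equation do not vanish *)

Section MatrixNorm.
Context {R : realType}.

Lemma le_mx_norm_entry m n (A : 'M[R]_(m, n)) i j : `|A i j| <= `|A|.
Proof.
rewrite [leRHS]/Num.Def.normr/= mx_normrE.
exact: (le_bigmax _ (fun ij : 'I_m * 'I_n => `|A ij.1 ij.2|) (i, j)).
Qed.

Lemma mx_norm_le m n (A : 'M[R]_(m, n)) (r : R) :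
  0 <= r -> (forall i j, `|A i j| <= r) -> `|A| <= r.
Proof.
by move=> r0 Ar; rewrite [leLHS]/Num.Def.normr/= mx_normrE bigmax_le.
Qed.

Lemma mx_norm_mulmx m n p (A : 'M[R]_(m, n)) (B : 'M[R]_(n, p)) :
  `|A *m B| <= n%:R * `|A| * `|B|.
Proof.
apply: mx_norm_le => [|i j]; first by rewrite !mulr_ge0.
rewrite mxE (le_trans (ler_norm_sum _ _ _))//.
apply: (@le_trans _ _ (\sum_(k < n) `|A| * `|B|)).
  by apply: ler_sum => k _; rewrite normrM ler_pM// le_mx_norm_entry.
by rewrite sumr_const card_ord -mulrA mulr_natl.
Qed.

Lemma measurable_mx_norm d (T : measurableType d) (D : set T) m n
    (A : T -> 'M[R]_(m, n)) :
  (forall i j, measurable_fun D (fun t => A t i j)) ->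
  measurable_fun D (fun t => `|A t|).
Proof.
move=> mA.
have -> : (fun t => `|A t|) =
    (fun t => \big[Num.max/0]_(ij : 'I_m * 'I_n) `|A t ij.1 ij.2|).
  by apply/funext => t; rewrite [LHS]/Num.Def.normr/= mx_normrE.
elim: (index_enum _) => [|ij s IH].
  by under eq_fun do rewrite big_nil; exact: measurable_cst.
under eq_fun do rewrite big_cons.
by apply: measurable_maxr => //; apply: measurableT_comp.
Qed.

Lemma ac_mulmx m n p (X : R -> 'M[R]_(m, n)) (B : 'M[R]_(n, p)) (a b : R) :
  absolutely_continuous_on a b X ->
  absolutely_continuous_on a b (fun t => X t *m B).
Proof.
move=> acX e e0; set K := n%:R * `|B| + 1.
have K0 : 0 < K by rewrite ltr_wpDl// mulr_ge0.
have [del del0 hdel] := acX (e / K) (divr_gt0 e0 K0).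
exists del => // N u v uv tuv suv.
apply: (@le_lt_trans _ _ (K * \sum_(k < N) `|X (v k) - X (u k)|)); last first.
  by rewrite mulrC -ltr_pdivlMr//; exact: hdel.
rewrite mulr_sumr; apply: ler_sum => k _.
rewrite -mulmxBl (le_trans (mx_norm_mulmx _ _))// mulrAC ler_wpM2r//.
by rewrite /K lerDl.
Qed.

Lemma ac_sub (V : normedModType R) (f : R -> V) (a b a' b' : R) :
  a <= a' -> b' <= b ->
  absolutely_continuous_on a b f -> absolutely_continuous_on a' b' f.
Proof.
move=> aa bb acf e e0; have [del del0 hdel] := acf e e0.
exists del => // N u v uv; apply: hdel => k; have [? [? ?]] := uv k.
by split; [exact: le_trans aa _|split=> //; exact: le_trans bb].
Qed.

End MatrixNorm.

Section LinearFlow.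
Context {R : realType} {d : nat}.
Variables A X : R -> 'M[R]_d.
Hypothesis intA : locally_integrable_coef A.
Hypothesis fundX : fundamental_matrix A X.

Lemma flow_norm_continuous (xi : 'cV[R]_d) :
  continuous (fun t : R => `|X (Num.max 0 t) *m xi|).
Proof.
case: fundX => _ acX _.
apply: (@ac_norm_continuous _ _ (fun t => X t *m xi)) => b b0.
exact/ac_mulmx/acX.
Qed.

(** Suppose the solution vanishes, first at time T > 0.  The majorant [G] of the
integral of the norm of A is bounded and monotone, so there is c < T such that
it grows by at most 1 / (2 K) between c and any later time before T.  If M is
the maximum of the norm of the solution between c and T, reached at [ts], the
mean value inequality bounds its increments after [ts] by K M times those of
[G], hence by M / 2.  So the norm is at least M / 2 up to T, and by continuity
it cannot vanish there. *)
Lemma flow_nonvanishing (t : R) (xi : 'cV[R]_d) :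
  0 <= t -> xi != 0 -> X t *m xi != 0.
Proof.
move=> t_ge0 xi0; apply/negP => /eqP Xt0.
case: intA => mA iA; case: fundX => X0 acX [N [mN N0 NP]].
pose v t := X t *m xi; pose w t := `|v (Num.max 0 t)|.
have wE s : 0 <= s -> w s = `|v s| by move=> s0; rewrite /w max_r.
have cw : continuous w by exact: flow_norm_continuous.
pose Z := [set s | 0 <= s /\ v s = 0].
have Zlb : lbound Z 0 by move=> s [].
have hiZ : has_inf Z by split; [exists t|exists 0].
pose T := inf Z.
have T_ge0 : 0 <= T by apply: lb_le_inf => //; exists t.
have near_w (s r : R) : 0 < r -> exists2 h, 0 < h &
    forall y, `|s - y| < h -> `|w s - w y| < r.
  move=> r0; have /cvgrPdist_lt/(_ r r0)/nbhs_ballP[h /= h0 hh] := cw s.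
  by exists h.
have wT : w T = 0.
  have wT_ge0 : 0 <= w T by exact: normr_ge0.
  apply/eqP; rewrite eq_le wT_ge0 andbT leNgt; apply/negP => wT0.
  have [h h0 hh] := near_w T _ wT0.
  have [z [z0 vz] zT] := inf_adherent h0 hiZ.
  have Tz : T <= z by apply: ge_inf => //; exists 0.
  have Tzh : `|T - z| < h by rewrite ler0_norm; rewrite -/T in zT; lra.
  by have := hh z Tzh; rewrite (wE z z0) vz normr0 subr0 (ger0_norm wT_ge0) ltxx.
have T_gt0 : 0 < T.
  rewrite lt_neqAle T_ge0 andbT; apply/eqP => T0.
  by move: wT; rewrite -T0 wE// /v X0 mul1mx => /eqP; rewrite normr_eq0 (negPf xi0).
have w_gt0 s : 0 <= s -> s < T -> 0 < w s.
  move=> s0 sT; rewrite wE// normr_gt0; apply/eqP => vs.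
  by move: sT; rewrite ltNge ge_inf//; exists 0.
have [G [Gmono Gloc]] : exists G : R -> R,
    (forall x y, x <= y -> G x <= G y) /\
    (forall t, 0 <= t <= T -> exists2 h, 0 < h &
       forall x y, x <= t -> t <= y -> y - x < h ->
         (`|A t| + 1) * (y - x) <= G y - G x).
  apply: integral_majorant => //; last by apply: iA; rewrite lexx.
  apply: (@measurable_funS _ _ (lebesgueType R) R (`[0, +oo[%classic : set R)).
  - by apply: sub_caratheodory; exact: measurable_itv.
  - by move=> s /=; rewrite !in_itv/= => /andP[->].
  - exact: measurable_mx_norm.
(* the norm of a product of matrices is at most d times the product of their
   norms; d + 1 is used because it is visibly positive *)
pose K : R := d.+1%:R.
have K0 : 0 < K by rewrite ltr0n.
have mulK m n (B : 'M[R]_(m, d)) (C : 'M[R]_(d, n)) : `|B *m C| <= K * `|B| * `|C|.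
  apply: le_trans (mx_norm_mulmx _ _) _.
  by rewrite -!mulrA ler_wpM2r ?mulr_ge0// /K ler_nat.
(* a left neighbourhood of the first zero on which the majorant G grows by
   less than half of 1 / K *)
have [c [c0 cT Gc]] : exists c, [/\ 0 <= c, c < T &
    forall s, s < T -> G s - G c <= (2 * K)^-1].
  pose E := [set G s | s in [set s | 0 <= s /\ s < T]].
  have EG s : 0 <= s -> s < T -> E (G s) by move=> *; exists s.
  have hsE : has_sup E.
    split; first by exists (G 0); exact: EG.
    by exists (G T) => _ [s [_ sT] <-]; apply: Gmono; exact: ltW.
  have K20 : 0 < (2 * K)^-1 by rewrite invr_gt0 mulr_gt0.
  have [_ [c [c0 cT] <-] supc] := sup_adherent K20 hsE.
  move: (2 * K)^-1 K20 supc => r r0 supc.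
  exists c; split=> // s sT.
  have [s0|s0] := leP 0 s.
    have : G s <= sup E by apply: ub_le_sup; [case: hsE|exact: EG].
    lra.
  by have := Gmono s c (le_trans (ltW s0) c0); lra.
have [ts tsI wmax] := EVT_max (ltW cT) (continuous_subspaceT (A := `[c, T]) cw).
move: tsI; rewrite in_itv/= => /andP[cts tsT].
set M := w ts in wmax.
have M0 : 0 < M.
  apply: lt_le_trans (w_gt0 c c0 cT) _; apply: wmax.
  by rewrite in_itv/= lexx ltW.
have {tsT} tsT : ts < T.
  rewrite lt_neqAle tsT andbT; apply: contraTneq M0 => e.
  by rewrite /M e wT ltxx.
have ts0 : 0 <= ts by exact: le_trans cts.
have half y : ts <= y -> y < T -> M / 2 <= w y.
  move=> tsy yT; have y0 := le_trans ts0 tsy.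
  have : `|v y - v ts| <= K * M * G y - K * M * G ts.
    apply: (@ac_increment_le _ _ v (fun s => K * M * G s) N) => //.
    - have T_ac := acX T T_gt0; apply: ac_mulmx; apply: ac_sub T_ac => //.
      exact: ltW.
    - by move=> x z _ xz _; rewrite ler_wpM2l ?Gmono// mulr_ge0// ltW.
    move=> s /andP[tss sy] Ns; have s0 := le_trans ts0 tss.
    have Xs : is_derive s (1 : R) X (A s *m X s).
      by apply: contrapT => h; apply: Ns; apply: NP => /= /(_ s0).
    have xin0 : 0 < `|xi| by rewrite normr_gt0.
    (* error M / |xi|: once applied to xi it accounts for the summand 1 in the
       growth rate |A| + 1 of the majorant *)
    have [h1 h10 hh1] := is_derive_straddle Xs (divr_gt0 M0 xin0).
    have [|h2 h20 hh2] := Gloc s; first by rewrite s0 (le_trans sy)// ltW.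
    exists (Num.min h1 h2); first by rewrite lt_min h10.
    move=> x z tsx xs sz zy; rewrite lt_min => /andP[zx1 zx2].
    have zx0 : 0 <= z - x by rewrite subr_ge0 (le_trans xs).
    have ws : `|v s| <= M.
      rewrite -wE//; apply: wmax; rewrite in_itv/= (le_trans cts tss).
      by rewrite (le_trans sy)// ltW.
    rewrite -mulrBr.
    apply: (@le_trans _ _ (K * M * ((`|A s| + 1) * (z - x)))); last first.
      by rewrite ler_wpM2l ?hh2// mulr_ge0// ltW.
    have -> : v z - v x =
        (X z - X x - (z - x) *: (A s *m X s)) *m xi + (z - x) *: (A s *m v s).
      by rewrite mulmxBl -scalemxAl -mulmxA subrK mulmxBl.
    have -> : K * M * ((`|A s| + 1) * (z - x)) =
        K * (M / `|xi| * (z - x)) * `|xi| + (z - x) * (K * `|A s| * M).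
      by field; rewrite gt_eqF.
    apply: le_trans (ler_normD _ _) _; apply: lerD.
      apply: le_trans (mulK _ _ _ _) _.
      by rewrite ler_wpM2r// ler_wpM2l ?(ltW K0)// hh1.
    rewrite normrZ ger0_norm// ler_wpM2l//.
    apply: le_trans (mulK _ _ _ _) _.
    by rewrite ler_wpM2l// mulr_ge0// ltW.
  rewrite -mulrBr => le1.
  have le2 : K * M * (G y - G ts) <= M / 2.
    have : G y - G ts <= (2 * K)^-1.
      move: (2 * K)^-1 Gc => r /(_ y yT); have := Gmono c ts cts; lra.
    move=> h; apply: le_trans (ler_wpM2l (ltW (mulr_gt0 K0 M0)) h) _.
    have -> : M / 2 = K * M * (2 * K)^-1 by field; rewrite gt_eqF.
    exact: lexx.
  have le3 : M - w y <= `|v y - v ts|.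
    by rewrite /M !wE// distrC; exact: lerB_dist.
  by have := le_trans le3 (le_trans le1 le2); lra.
have [h h0 hh] := near_w T (M / 2) (divr_gt0 M0 (ltr0Sn R 1)).
pose y := Num.max ts (T - h / 2).
have yT : y < T by rewrite gt_max tsT /=; lra.
have tsy : ts <= y by rewrite le_max lexx.
have hy : T - h / 2 <= y by rewrite le_max lexx orbT.
have Tyh : `|T - y| < h by rewrite ger0_norm; lra.
have wy0 : 0 <= w y by exact: normr_ge0.
have := hh y Tyh; rewrite wT sub0r normrN (ger0_norm wy0).
by rewrite ltNge half.
Qed.

End LinearFlow.

(** * Unbounded components, and the theorem *)

Section ExtremeComponents.
Context {R : realType}.
Implicit Types (Sigma : set (\bar R)) (I : nat -> set (\bar R)).

Lemma ninfty_first_component Sigma k I :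
  ordered_components Sigma k I -> Sigma -oo%E -> unbounded_below (I 1%N).
Proof.
move=> [nI oI _ SE]; rewrite SE => -[j /= /andP[j1 jk] Ij].
have {}j1 : j = 1%N.
  apply/eqP; rewrite eqn_leq j1 andbT leqNgt; apply/negP => j2.
  have jp : j.-1.+1 = j by rewrite prednK.
  have j1k : (1 <= j.-1 < k)%N by rewrite jp jk -ltnS jp j2.
  have [|[x Ix] _] := nI j.-1; first by case/andP: j1k => -> /ltnW.
  have := oI j.-1 j1k x -oo%E Ix; rewrite jp => /(_ Ij).
  by rewrite ltNge leNye.
by move=> M; exists -oo%E; [rewrite -j1|exact: ltNyr].
Qed.

Lemma pinfty_last_component Sigma k I :
  ordered_components Sigma k I -> Sigma +oo%E -> unbounded_above (I k).
Proof.
move=> [nI oI _ SE]; rewrite SE => -[j /= /andP[j1 jk] Ij].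
have {}jk : j = k.
  apply/eqP; rewrite eqn_leq jk /= leqNgt; apply/negP => ltjk.
  have [|[x Ix] _] := nI j.+1; first by [].
  have jr : (1 <= j < k)%N by rewrite j1.
  by have := oI j jr +oo%E x Ij Ix; rewrite ltNge leey.
by move=> M; exists +oo%E; [rewrite -jk|exact: ltry].
Qed.

End ExtremeComponents.

Section GaussianFlow.
Context {R : realType} {d : nat}.
Variable c : R.

Definition gaussian_coef (t : R) : 'M[R]_d := (2 * c * t) *: 1%:M.
Definition gaussian_flow (t : R) : 'M[R]_d := expR (c * t ^+ 2) *: 1%:M.

Lemma gaussian_coef_locally_integrable : locally_integrable_coef gaussian_coef.
Proof.
have mA i j : @measurable_fun _ _ (lebesgueType R) R setT (fun t => gaussian_coef t i j).
  have : measurable_fun [set: R] (fun t => gaussian_coef t i j).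
    apply: continuous_measurable_fun => t.
    have -> : (fun s => gaussian_coef s i j) =
        (fun s => 2 * c * s * (1%:M : 'M[R]_d) i j).
      by apply/funext => s; rewrite mxE.
    by apply: cvgMl; apply: cvgMr; exact: cvg_id.
  move=> mB _ Y mY; apply: sub_caratheodory; exact: mB.
split=> [i j|a b /andP[a0 ab]].
  exact: measurable_funS (mA i j).
have mab : measurable (`[a, b]%classic : set (lebesgueType R)).
  by apply: sub_caratheodory; exact: measurable_itv.
pose C := 2 * `|c| * b * `|1%:M : 'M[R]_d|.
have C0 : 0 <= C.
  by rewrite /C !mulr_ge0//; apply: le_trans a0 (ltW ab).
apply: (@le_lt_trans _ _ (\int[completed_lebesgue_measure]_(t in
    (`[a, b]%classic : set R)) (cst C%:E t))%E).
  apply: ge0_le_integral => //.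
  - apply/measurable_EFinP; apply: measurable_mx_norm => i j.
    exact: measurable_funS (mA i j).
  - move=> t /=; rewrite in_itv/= lee_fin => /andP[a_t tb].
    have t0 : 0 <= t by exact: le_trans a_t.
    rewrite /gaussian_coef /C normrZ ler_wpM2r// !normrM (ger0_norm t0) normr_nat.
    by rewrite ler_wpM2l// mulr_ge0.
rewrite integral_cst//.
have e : completed_lebesgue_measure (`[a, b]%classic : set R) = (b - a)%:E.
  by have := lebesgue_measure_itv `[a, b]; rewrite /= lte_fin ab.
have e2 : (C%:E * completed_lebesgue_measure (`[a, b]%classic : set R))%E
    = (C * (b - a))%:E by rewrite e EFinM.
exact: (eq_ind_r (fun z => (z < +oo)%E) (ltry _) e2).
Qed.

Lemma is_derive_gaussian (t : R) :
  is_derive t (1 : R) (fun s : R => expR (c * s ^+ 2)) (2 * c * t * expR (c * t ^+ 2)).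
Proof.
apply: is_derive_eq.
rewrite /GRing.scale /=; ring.
Qed.

Lemma gaussian_lipschitz (b : R) : 0 < b -> exists2 K, 0 < K &
  forall x y, 0 <= x -> x < y -> y <= b ->
    `|expR (c * y ^+ 2) - expR (c * x ^+ 2)| <= K * (y - x).
Proof.
move=> b0; exists (2 * (`|c| + 1) * b * expR (`|c| * b ^+ 2)).
  by rewrite !mulr_gt0 ?expR_gt0// ltr_wpDl.
move=> x y x0 xy yb.
have [|z zI ->] := MVT xy (fun z _ => is_derive_gaussian z).
  apply: continuous_subspaceT => z; apply: differentiable_continuous.
  by apply/derivable1_diffP; case: (is_derive_gaussian z).
move: zI; rewrite in_itv/= => /andP[xz zy].
have z0 : 0 <= z by exact: le_trans (ltW xz).
have zb : z <= b by exact: le_trans (ltW zy) yb.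
rewrite normrM [X in _ * X]ger0_norm ?subr_ge0 ?(ltW xy)//.
rewrite ler_wpM2r ?subr_ge0 ?(ltW xy)// !normrM normr_nat (ger0_norm z0).
rewrite [X in _ * X]ger0_norm ?expR_ge0//.
apply: ler_pM; rewrite ?expR_ge0 ?mulr_ge0//.
  apply: ler_pM; rewrite ?mulr_ge0//.
  by rewrite ler_wpM2l// lerDl.
rewrite ler_expR; apply: (@le_trans _ _ (`|c| * z ^+ 2)).
  by rewrite ler_wpM2r ?sqr_ge0// ler_norm.
by rewrite ler_wpM2l// lerXn2r// ?nnegrE// ltW.
Qed.

Lemma gaussian_fundamental : fundamental_matrix gaussian_coef gaussian_flow.
Proof.
split.
- by rewrite /gaussian_flow expr0n /= mulr0 expR0 scale1r.
- move=> b b0 e e0; have [K K0 lip] := gaussian_lipschitz b0.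
  pose L := K * `|1%:M : 'M[R]_d| + 1.
  have L0 : 0 < L by rewrite ltr_wpDl// mulr_ge0// ltW.
  exists (e / L) => [|n u v uv _ suv]; first exact: divr_gt0.
  apply: (@le_lt_trans _ _ (L * \sum_(k < n) (v k - u k))); last first.
    by rewrite mulrC -ltr_pdivlMr.
  rewrite mulr_sumr; apply: ler_sum => k _; have [u0 [uvk vb]] := uv k.
  rewrite /gaussian_flow -scalerBl normrZ.
  apply: (@le_trans _ _ (K * (v k - u k) * `|1%:M : 'M[R]_d|)).
    by rewrite ler_wpM2r// lip.
  by rewrite mulrAC ler_wpM2r ?subr_ge0 ?(ltW uvk)// /L lerDl.
- apply: aeW => t _.
  have D i j : is_derive t (1 : R) (fun s => gaussian_flow s i j)
      ((2 * c * t * expR (c * t ^+ 2)) * (1%:M : 'M[R]_d) i j).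
    have -> : (fun s => gaussian_flow s i j) =
        (fun s => (1%:M : 'M[R]_d) i j *: expR (c * s ^+ 2)).
      by apply/funext => s; rewrite mxE mulrC.
    have := is_derive_gaussian t => h.
    by apply: is_derive_eq; rewrite /GRing.scale /= mulrC.
  have dX : derivable gaussian_flow t 1.
    by apply/derivable_mxP => i j; case: (D i j).
  split=> //; rewrite derive_mx//; apply/matrixP => i j.
  rewrite mxE (@derive_val _ _ _ _ _ _ _ (D i j)).
  by rewrite /gaussian_coef /gaussian_flow -scalemxAl mul1mx scalerA !mxE.
Qed.

(** Between the times 0 and n every nonzero solution has slope c n. *)
Lemma gaussian_bohl_spectrum (l : \bar R) : (1 <= d)%N ->
  (c * n%:R)%:E @[n --> \oo] --> l -> bohl_spectrum gaussian_flow l.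
Proof.
move=> d1 cl; pose xi : 'cV[R]_d := const_mx 1.
have xi0 : xi != 0.
  by apply/eqP => /matrixP/(_ (Ordinal d1) 0)/eqP; rewrite !mxE oner_eq0.
exists xi => //; exists (fun n => n%:R), (fun=> 0); split=> //.
  apply: (gap_cvg_pinfty (u := fun n => n%:R - 0) (e := id)) => // n.
  by rewrite subr0.
move: cl; apply: cvg_trans; apply: near_eq_cvg; near=> n.
congr (_%:E); rewrite subr0 /gaussian_flow -!scalemxAl !mul1mx !normrZ.
rewrite expr0n /= mulr0 expR0 normr1 mul1r mulfK ?normr_eq0//.
rewrite ger0_norm ?expR_ge0// expRK expr2.
have [->|n0] := eqVneq (n%:R : R) 0; first by rewrite !mulr0.
by rewrite mulrCA mulKf.
Unshelve. all: by end_near. Qed.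

End GaussianFlow.

Theorem theorem12 (R : realType) (d : nat) (hd : (1 <= d)%N) :
  (forall A X : R -> 'M[R]_d,
     locally_integrable_coef A -> fundamental_matrix A X ->
     exists (k : nat) (I : nat -> set (\bar R)),
       [/\ (1 <= k <= d)%N,
           ordered_components (bohl_spectrum X) k I,
           forall i, (1 < i < k)%N -> ereal_bounded (I i) &
           exists S : nat -> {vspace 'cV[R]_d},
             [/\ S 0%N = 0%VS,
                 forall i, (i < k)%N -> (S i <= S i.+1)%VS /\ S i <> S i.+1,
                 S k = fullv &
                 forall i, (1 <= i <= k)%N ->
                   [set xi | xi \in S i /\ xi != 0] =
                   [set xi : 'cV[R]_d | xi != 0 /\
                      solution_bohl_spectrum X xi `<=`
                        \bigcup_(j in [set j | (1 <= j <= i)%N]) I j]]]) /\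
  (exists (A X : R -> 'M[R]_d) (k : nat) (I : nat -> set (\bar R)),
     [/\ locally_integrable_coef A, fundamental_matrix A X, (1 <= k)%N,
         ordered_components (bohl_spectrum X) k I & unbounded_below (I 1%N)]) /\
  (exists (A X : R -> 'M[R]_d) (k : nat) (I : nat -> set (\bar R)),
     [/\ locally_integrable_coef A, fundamental_matrix A X, (1 <= k)%N,
         ordered_components (bohl_spectrum X) k I & unbounded_above (I k)]).
Proof.
have main (A X : R -> 'M[R]_d) (hA : locally_integrable_coef A)
    (hX : fundamental_matrix A X) :=
  flow_spectral_filtration hd (flow_norm_continuous hX)
    (@flow_nonvanishing _ _ _ _ hA hX).
have natoo : (n%:R : R) @[n --> \oo] --> +oo.
  exact: (gap_cvg_pinfty (u := fun n => n%:R) (e := id)).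
split; first exact: main.
split.
  have hA := gaussian_coef_locally_integrable (d := d) (-1 : R).
  have hX := gaussian_fundamental (d := d) (-1 : R).
  have [k [I [/andP[k1 _] comp _ _]]] := main _ _ hA hX.
  exists (gaussian_coef (-1)), (gaussian_flow (-1)), k, I; split=> //.
  apply: (ninfty_first_component comp); apply: gaussian_bohl_spectrum => //.
  move/cvgeryP/cvgeN : natoo; apply: cvg_trans; apply: near_eq_cvg; near=> n.
  by rewrite /= mulN1r.
have hA := gaussian_coef_locally_integrable (d := d) (1 : R).
have hX := gaussian_fundamental (d := d) (1 : R).
have [k [I [/andP[k1 _] comp _ _]]] := main _ _ hA hX.
exists (gaussian_coef 1), (gaussian_flow 1), k, I; split=> //.
apply: (pinfty_last_component comp); apply: gaussian_bohl_spectrum => //.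
under eq_fun do rewrite mul1r.
exact/cvgeryP.
Unshelve. all: by end_near. Qed.
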